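(* Let $\tau:[0,\infty)\to[0,\infty)$ be continuous with $\lim_{t\to\infty}\{t-\tau(t)\}=\infty$, and let $\bar\tau$ be defined by $-\bar{\tau}=\inf_{t\ge 0}\{t-\tau(t)\}$. Let $\sigma:[-\bar\tau,\infty)\to[0,\infty)$ be continuous and such that $$\lim_{t\to\infty}\int_0^t\frac{1}{\sigma(s)}\,ds=\infty,\qquad \lim_{t\to\infty}\sigma(t)=\infty,\qquad \lim_{t\to\infty}\int_{t-\tau(t)}^t\frac{1}{\sigma(s)}\,ds=1,$$ and suppose there exists $\lambda\in[0,\infty]$ such that $\lim_{t\to\infty}\sigma(t)/t=\lambda$. Let $a>b>0$ and let $g:[0,\infty)\to[0,\infty)$ be continuous with $g(0)=0$, $g(x)>0$ for $x>0$, such that there is $\delta_1>0$ with $g\in C^1(0,\delta_1)$ and $g'(x)>0$ for $x\in(0,\delta_1)$, and there is $\beta>1$ with $g'\in \mathrm{RV}_0(\beta-1)$. Let $\psi\in C([-\bar\tau,0];(0,\infty))$. Suppose that the solution $x$ of $$x'(t)=-ag(x(t))+b\max_{t-\tau(t)\le s\le t}g(x(s)),\quad t\ge 0;\qquad x(t)=\psi(t),\quad t\in[-\bar\tau,0],$$ obeys $x(t)\to0$ as $t\to\infty$. Let $G(x)=\int_x^1\frac{1}{g(u)}\,du$ for $x>0$. (i) If $\lambda=0$, then $\displaystyle\lim_{t\to\infty}\frac{x(t)}{G^{-1}(t)}=(a-b)^{-1/(\beta-1)}$. (ii) If $0<\lambda<\frac{\beta-1}{\beta}\log(a/b)$, put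 $q=1-e^{-\lambda}$ and $\Lambda=\left(a-b\left(\frac{1}{1-q}\right)^{\beta/(\beta-1)}\right)^{-1/(\beta-1)}$. Then $$\Lambda\le\liminf_{t\to\infty}\frac{x(t)}{G^{-1}(t)}\le\limsup_{t\to\infty}\frac{x(t)}{G^{-1}(t)}<+\infty.$$ (iii) If $\frac{\beta-1}{\beta}\log(a/b)<\lambda<+\infty$, then $\displaystyle\lim_{t\to\infty}\frac{\log x(t)}{\log t}=-\frac1\beta\,\frac1\lambda\log\left(\frac ab\right)$. (iv) If $\lambda=\infty$, then $\displaystyle\lim_{t\to\infty}\frac{\log x(t)}{\int_0^t\frac{1}{\sigma(s)}\,ds}=-\frac1\beta\log\left(\frac ab\right)$.
   Context: A function $f$, positive near $0$ on the right, is regularly varying at zero with exponent $\alpha\in\mathbb{R}$, written $f\in\mathrm{RV}_0(\alpha)$, if $\lim_{t\to0^+}f(\lambda t)/f(t)=\lambda^\alpha$ for all $\lambda>0$. A solution of the equation is a continuous function $x:[-\bar\tau,\infty)\to(0,\infty)$, differentiable on $[0,\infty)$ (one-sided at $0$), satisfying the equation for all $t\ge0$ and equal to $\psi$ on $[-\bar\tau,0]$; solutions are positive. $G$ is strictly decreasing on $(0,\infty)$ with $G(x)\to\infty$ as $x\to0^+$, and $G^{-1}$ is its inverse. The integrals of $1/\sigma$ over compact intervals are understood to be finite. *)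

(* Defs.v *)
From mathcomp Require Export all_boot all_order all_algebra.
From mathcomp Require Export all_classical all_reals all_analysis.
Export Order.TTheory GRing.Theory Num.Theory.
Export numFieldNormedType.Exports.

Set Implicit Arguments.
Unset Strict Implicit.
Unset Printing Implicit Defensive.

Local Open Scope classical_set_scope.
Local Open Scope ring_scope.

(* Functions on a half-line or interval are total functions R -> R whose values
   outside that domain are never constrained. *)

Section Definitions.
Context {R : realType}.
Implicit Types (f g tau sigma psi x : R -> R) (a b t u v alpha : R).

Definition RV0 alpha f : Prop :=
  (\forall t \near 0^'+, 0 < f t) /\
  forall k, 0 < k -> f (k * t) / f t @[t --> 0^'+] --> k `^ alpha.

Definition taubar tau : R := - inf [set t - tau t | t in `[0, +oo[].

(* The inverse is taken in \bar R, where 0^-1 = +oo, so that a sigma vanishing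
   on a set of positive measure has an infinite integral. *)
Definition int_inv sigma u v : \bar R :=
  (\int[@lebesgue_measure R]_(s in `[u, v]) ((sigma s)%:E)^-1)%E.

(* The oriented integral of 1 / g from y to 1. *)
Definition G g (y : R) : R :=
  if y <= 1 then \int[@lebesgue_measure R]_(u in `[y, 1]) (g u)^-1
  else - \int[@lebesgue_measure R]_(u in `[1, y]) (g u)^-1.

Definition Ginv g : R -> R := 'pinv_(fun=> 0) `]0, +oo[ (G g).

(* For g \o x continuous on [u, v], u <= v, this supremum is attained. *)
Definition max_on g x u v : R := sup [set g (x s) | s in `[u, v]].

Definition rhs a b g tau x t : R :=
  - a * g (x t) + b * max_on g x (t - tau t) t.

Record is_solution a b g tau psi x : Prop := IsSolution {
  sol_pos : forall t : R, - taubar tau <= t -> 0 < x t;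
  sol_cont : {within `[- taubar tau, +oo[, continuous x};
  sol_deriv : forall t : R, 0 < t -> is_derive t 1 x (rhs a b g tau x t);
  sol_deriv0 : (x h - x 0) / h @[h --> 0^'+] --> rhs a b g tau x 0;
  sol_init : forall t : R, - taubar tau <= t <= 0 -> x t = psi t
}.

End Definitions.

(* Main.v *)
Require Import Defs.
From mathcomp Require Import measurable_realfun ring lra.

(** Put h = g o G^-1 and write the solution as x = G^-1(y).  Then
    y' = a - b max h(y(s)) / h(y(t)), the maximum being over the delay
    interval; since x eventually stays where g increases, the maximum of g(x)
    is g of the maximum of x.  The whole theorem follows from comparing x with
    explicit decreasing functions u: if u starts above (below) x and satisfies
    u'(t) > (<) - a g(u(t)) + b g(u(t - tau(t))), then x cannot cross u, because
    at a first crossing the derivative of the difference has the wrong sign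
    (compare_above, compare_below).

    Regular variation enters through monotonicity of increments: if k f(k t) is
    close to l f(t), then F(k x) - l F(x) has small increments relative to F,
    where F' = f.  Applied to f = g' this gives g in RV(beta)
    (g_RV_of_derive), and applied to f = 1/g it gives G in RV(1 - beta)
    (G_RV); inverting, G^-1 and g o G^-1 vary regularly at infinity with
    exponents -1/(beta-1) and -beta/(beta-1) (Gam_RV, gGam_RV).  Power bounds
    on g come from halving the argument.

    The regime lambda < ((beta-1)/beta) ln(a/b).  Let S(t) be the integral of
    1/sigma over [0, t].  As (ln t)' = (sigma(t)/t) S'(t), the condition S(t) - S(t - tau(t)) -> 1
    becomes ln t - ln (t - tau(t)) -> lambda, that is (t - tau(t))/t -> r with
    r = exp(-lambda) (delay_ratio_cvg).  With y of order K t the equation for y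
    balances when K = a - b r^(-beta/(beta-1)).  The comparison functions
    are G^-1(w) with w(t) = K' t + D t^(1-nu) and K' slightly above K,
    respectively w(t) = M + K' t^(1+nu) / (t^nu + D) and K' slightly below K.  The slowly fading correction makes
    the initial ordering hold, by taking D large, while w(t - tau(t))/w(t) is
    perturbed only by the small exponent nu, so that the time from which the
    differential inequality holds does not depend on D.  Hence y(t)/t -> K, and
    x/G^-1 has the limit K^(-1/(beta-1)), which is (a-b)^(-1/(beta-1)) when
    lambda = 0 and the constant Lambda otherwise (slow_delay_limit); so the
    lower and upper limits in the second conclusion both equal Lambda.

    The regime lambda > ((beta-1)/beta) ln(a/b).  On the scale of S
    the delay is asymptotically 1, so exp(-m S) is multiplied by about exp(m) over one delay, and a g(u) balances
    b g(u(t - tau(t))) when exp(m beta) = a/b, that is for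
    mu = ln(a/b)/beta.  For m > mu the function c exp(-m S) lies below x.  For
    m < mu the function C exp(-m S) lies above x, provided that
    u'/g(u), of order 1 / (sigma u^(beta-1)), is negligible; this is the case
    when sigma exp(-mu (beta-1) S) -> +oo, which sigma >= l t with
    l > mu (beta-1) guarantees, since then S <= (ln t)/l + C.  So
    ln x / S -> - mu (fast_delay_limit); for finite lambda,
    ln t / S -> lambda turns this into the limit of ln x / ln t. *)

Set Implicit Arguments.
Unset Strict Implicit.
Unset Printing Implicit Defensive.

Local Open Scope classical_set_scope.
Local Open Scope ring_scope.

(** * Calculus and asymptotic criteria *)

Section Calculus.
Context {R : realType}.
Implicit Types (f g h z : R -> R) (P : R -> Prop).

Lemma near_pinftyP P :
  (\forall t \near +oo, P t) <-> exists2 T, 0 < T & forall t, T <= t -> P t.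
Proof.
split=> [[M [_ H]]|[T T0 H]].
  exists (`|M| + 1); first by rewrite ltr_pwDr.
  move=> t Mt; apply: H; rewrite (lt_le_trans _ Mt)//.
  by rewrite (le_lt_trans (ler_norm _))// ltrDl.
exists T; split; first exact: num_real.
by move=> t /ltW; apply: H.
Qed.

Lemma near_at_right0P P :
  (\forall t \near 0^'+, P t) <-> exists2 d, 0 < d & forall t, 0 < t <= d -> P t.
Proof.
split=> [[e /= e0 H]|[d d0 H]].
  exists (e / 2); first by rewrite divr_gt0.
  move=> t /andP[t0 te]; apply: H => //=.
  rewrite sub0r normrN gtr0_norm//; lra.
exists d => //= t /=; rewrite sub0r normrN => td t0; apply: H.
by rewrite t0 (le_trans (ler_norm _))// ltW.
Qed.

Lemma ubound4 (t1 t2 t3 t4 : R) :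
  exists T, [/\ t1 <= T, t2 <= T, t3 <= T & t4 <= T].
Proof.
exists (Num.max (Num.max t1 t2) (Num.max t3 t4)).
by split; rewrite !le_max lexx ?orbT.
Qed.

Lemma cvg_ratioP {F : set_system R} {FF : Filter F} f h (l : R) :
  (\forall t \near F, 0 < h t) ->
  f t / h t @[t --> F] --> l <->
  forall e, 0 < e -> \forall t \near F, `|f t - l * h t| <= e * h t.
Proof.
move=> h0.
have key e t : 0 < h t -> (`|l - f t / h t| <= e) = (`|f t - l * h t| <= e * h t).
  move=> ht; rewrite -[X in _ = (_ <= _ * X)](gtr0_norm ht) -ler_pdivrMr ?normr_gt0 ?gt_eqF//.
  rewrite -normf_div distrC; congr (`|_| <= _).
  by field; rewrite gt_eqF.
split=> [/cvgrPdist_le H e e0|H].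
  by have := H _ e0; apply: filterS2 h0 => t ht; rewrite key.
apply/cvgrPdist_le => e e0; have := H _ e0.
by apply: filterS2 h0 => t ht; rewrite key.
Qed.

(** The bounded error C is absorbed because h tends to infinity; for f' close to
    l h', integrating gives exactly a bound of this form, so this is
    L'Hospital's rule for an infinite denominator. *)
Lemma cvg_ratio_infty {F : set_system R} {FF : Filter F} f h (l : R) :
  h t @[t --> F] --> +oo ->
  (forall e, 0 < e -> exists C, \forall t \near F, `|f t - l * h t| <= e * h t + C) ->
  f t / h t @[t --> F] --> l.
Proof.
move=> hoo H; apply/cvg_ratioP; first by move/cvgryPgt : hoo => /(_ 0).
move=> e e0; have [|C HC] := H (e / 2); first by rewrite divr_gt0.
have /cvgryPge/(_ (C / (e / 2))) := hoo.
apply: filterS2 HC => t h1 h2; apply: (le_trans h1).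
have : C <= e / 2 * h t by rewrite mulrC -ler_pdivrMr// divr_gt0.
lra.
Qed.

Lemma is_derive_continuous f (t l : R) : is_derive t 1 f l -> {for t, continuous f}.
Proof. by move=> [fd _]; apply/differentiable_continuous/derivable1_diffP. Qed.

Lemma is_derive_ndecr f f' (s t : R) : s <= t ->
  (forall u, s <= u <= t -> is_derive u 1 f (f' u)) ->
  (forall u, s <= u <= t -> 0 <= f' u) -> f s <= f t.
Proof.
move=> st fd f0.
have [||c /[!in_itv]/= cst E] := @MVT_segment _ f f' s t st.
- by move=> u /[!in_itv]/= /andP[/ltW su /ltW ut]; apply: fd; rewrite su ut.
- apply: continuous_in_subspaceT => u /[!inE]/=; rewrite in_itv/= => ust.
  exact: is_derive_continuous (fd _ ust).
- by rewrite -subr_ge0 E mulr_ge0 ?f0// subr_ge0.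
Qed.

Lemma is_derive_lt f f' (s t : R) : s < t ->
  (forall u, s <= u <= t -> is_derive u 1 f (f' u)) ->
  (forall u, s <= u <= t -> 0 < f' u) -> f s < f t.
Proof.
move=> st fd f0.
have [||c /[!in_itv]/= /andP[/ltW sc /ltW ct] E] := @MVT _ f f' s t st.
- by move=> u /[!in_itv]/= /andP[/ltW su /ltW ut]; apply: fd; rewrite su ut.
- apply: continuous_in_subspaceT => u /[!inE]/=; rewrite in_itv/= => ust.
  exact: is_derive_continuous (fd _ ust).
- by rewrite -subr_gt0 E mulr_gt0 ?f0 ?sc// subr_gt0.
Qed.

(** At the infimum s of the points where z <= 0, continuity forces z s = 0, and a
    positive derivative there would make z negative just before s. *)
Lemma first_crossing_gt0 z (T0 T : R) : T0 <= T ->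
  (forall t, T0 <= t -> {for t, continuous z}) ->
  (forall s, T0 <= s <= T -> 0 < z s) ->
  (forall t, T < t -> T0 <= t -> z t = 0 -> (forall s, T0 <= s <= t -> 0 <= z s) ->
     exists2 l : R, 0 < l & is_derive t 1 z l) ->
  forall t, T0 <= t -> 0 < z t.
Proof.
move=> T0T zc z0 zd t1 Tt1; rewrite ltNge; apply/negP => zt1.
pose A := [set t | T0 <= t /\ z t <= 0].
have A1 : A t1 by [].
have infA : has_inf A by split; [exists t1|exists T0 => ? []].
pose s := inf A.
have T0s : T0 <= s by apply: lb_le_inf; [exists t1|move=> ? []].
have zlt r : T0 <= r -> r < s -> 0 < z r.
  move=> T0r rs; rewrite ltNge; apply/negP => zr.
  by have := ge_inf infA.2 (conj T0r zr : A r); rewrite leNgt rs.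
have zs_le : z s <= 0.
  rewrite leNgt; apply/negP => zs.
  have /(_ _ _ zs) := cvgr_gt _ (zc _ T0s).
  move=> [e /= e0 He].
  have [r [T0r zr] rs] := inf_adherent e0 infA.
  have := He r; rewrite /= [X in _ -> is_true X]ltNge zr/=; suff -> : `|s - r| < e by move/(_ isT).
  rewrite distrC ger0_norm ?subr_ge0; last exact: (ge_inf infA.2 (conj T0r zr : A r)).
  by rewrite ltrBlDl.
have Ts : T < s.
  rewrite ltNge; apply/negP => sT; move: zs_le; rewrite leNgt z0//.
  by rewrite T0s sT.
have T0s' : T0 < s by rewrite (le_lt_trans T0T).
have zs_ge r : T0 <= r <= s -> 0 <= z r.
  move=> /andP[T0r]; rewrite le_eqVlt => /orP[/eqP->|rs]; last exact/ltW/zlt.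
  rewrite leNgt; apply/negP => zsN.
  have /(_ _ _ zsN)[e /= e0 He] := cvgr_lt _ (zc _ T0s).
  pose q := Num.max T0 (s - e / 2).
  have qs : q < s by rewrite gt_max T0s'/= ltrBlDr ltrDl divr_gt0.
  have Tq : T0 <= q by rewrite le_max lexx.
  have := He q; rewrite /= [X in _ -> is_true X]ltNge ltW ?zlt//=.
  rewrite gtr0_norm ?subr_gt0//; suff -> : s - q < e by move/(_ isT).
  have : s - e / 2 <= q by rewrite le_max lexx orbT.
  move: e0; lra.
have zs0 : z s = 0 by apply/eqP; rewrite eq_le zs_le zs_ge ?lexx ?T0s.
have [l l0 [zsd zsl]] := zd s Ts T0s zs0 zs_ge.
have : h^-1 *: (z (h + s) - z s) @[h --> 0^'] --> l.
  by rewrite -zsl; have := zsd; rewrite /derivable /derive /=; under eq_fun do rewrite [_ *: 1]mulr1.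
move=> /cvgr_gt/(_ _ l0)[e /= e0 He].
(* A step to the left that stays within [T0, s]. *)
pose h := - Num.min (e / 2) ((s - T0) / 2).
have h0 : h < 0 by rewrite oppr_lt0 lt_min !divr_gt0// subr_gt0.
have he : - e / 2 <= h by rewrite /h mulNr lerN2 ge_min lexx.
have hT : T0 <= h + s.
  have : - ((s - T0) / 2) <= h by rewrite lerN2 ge_min lexx orbT.
  lra.
have /= := He h; rewrite sub0r normrN ltr0_norm//.
have -> : - h < e by lra.
move=> /(_ isT); rewrite lt_eqF// => /(_ isT).
rewrite zs0 subr0 [_ *: _]mulrC ltNge => /negP; apply.
rewrite ler_ndivrMr// mul0r zs_ge// hT/=; lra.
Qed.
End Calculus.

(** * Comparison for the delay equation; power bounds by halving *)

Section Comparison.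
Context {R : realType} (a b : R) (g tau x : R -> R) (d : R).
Hypothesis b_gt0 : 0 < b.
Hypothesis g_ndecr : forall y z, 0 < y -> y <= z -> z <= d -> g y <= g z.

Lemma max_on_le (s t M : R) : s <= t ->
  (forall r, s <= r <= t -> g (x r) <= M) -> max_on g x s t <= M.
Proof.
move=> st H; apply: ge_sup; first by exists (g (x s)), s => //=; rewrite in_itv/= lexx.
by move=> y [r /= + <-]; rewrite in_itv/=; exact: H.
Qed.

Lemma max_on_ge (s t : R) : s <= t ->
  (forall r, s <= r <= t -> 0 < x r <= d) -> g (x s) <= max_on g x s t.
Proof.
move=> st H; apply: ub_le_sup; last by exists s => //=; rewrite in_itv/= lexx.
exists (g d) => y [r /= + <-]; rewrite in_itv/= => /H/andP[x0 xd].
exact: g_ndecr.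
Qed.

(** T0 is a time after which x is small, and T >= T0 a time
    after which the delayed argument is itself past T0: the ordering is
    assumed on [T0, T] and propagated from there. *)
Variables (u : R -> R) (T0 T : R).
Hypothesis T0T : T0 <= T.
Hypothesis x_gt0 : forall t, T0 <= t -> 0 < x t.
Hypothesis x_deriv : forall t, T0 <= t -> is_derive t 1 x (rhs a b g tau x t).
Hypothesis delay : forall t, T < t -> T0 <= t - tau t <= t.
Hypothesis u_cont : forall t, T0 <= t -> {for t, continuous u}.

(** At a first time with x = u, all delayed values satisfy
    x s <= u s <= u (t - tau t), so x' <= - a g(u) + b g(u (t - tau t)) < u'. *)
Lemma compare_above :
  (forall s t, T0 <= s -> s <= t -> u t <= u s) ->
  (forall s, T0 <= s <= T -> x s < u s) ->
  (forall t, T < t -> u (t - tau t) <= d /\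
     exists2 l : R, is_derive t 1 u l & - a * g (u t) + b * g (u (t - tau t)) < l) ->
  forall t, T0 <= t -> x t < u t.
Proof.
move=> u_nincr xu0 H t T0t; rewrite -subr_gt0.
apply: (@first_crossing_gt0 _ (fun t => u t - x t) T0 T) => //.
- move=> s T0s; apply: cvgB; first exact: u_cont.
  exact: is_derive_continuous (x_deriv T0s).
- by move=> s /xu0; rewrite subr_gt0.
move=> s Ts T0s /eqP; rewrite subr_eq0 => /eqP uxE zge.
have [upd [l ul lgt]] := H _ Ts; have /andP[T0p ps] := delay Ts.
exists (l - rhs a b g tau x s); last by apply: is_deriveB => //; exact: x_deriv.
rewrite subr_gt0 (le_lt_trans _ lgt)// /rhs uxE lerD2l ler_pM2l//.
apply: max_on_le => // r /andP[pr rs]; have T0r := le_trans T0p pr.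
apply: g_ndecr => //; first exact: x_gt0.
rewrite (le_trans _ (u_nincr _ _ T0p pr))// -subr_ge0 zge//.
by rewrite T0r.
Qed.

(** At a first time with x = u the maximum is at least g(x (t - tau t)), and
    x >= u at the delayed time, so x' >= - a g(u) + b g(u (t - tau t)) > u'. *)
Lemma compare_below :
  (forall t, T0 <= t -> x t <= d) ->
  (forall t, T0 <= t -> 0 < u t) ->
  (forall s, T0 <= s <= T -> u s < x s) ->
  (forall t, T < t ->
     exists2 l : R, is_derive t 1 u l & l < - a * g (u t) + b * g (u (t - tau t))) ->
  forall t, T0 <= t -> u t < x t.
Proof.
move=> x_le u_gt0 xu0 H t T0t; rewrite -subr_gt0.
apply: (@first_crossing_gt0 _ (fun t => x t - u t) T0 T) => //.
- move=> s T0s; apply: cvgB; last exact: u_cont.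
  exact: is_derive_continuous (x_deriv T0s).
- by move=> s /xu0; rewrite subr_gt0.
move=> s Ts T0s /eqP; rewrite subr_eq0 => /eqP uxE zge.
have [l ul lgt] := H _ Ts; have /andP[T0p ps] := delay Ts.
exists (rhs a b g tau x s - l); last by apply: is_deriveB => //; exact: x_deriv.
rewrite subr_gt0 (lt_le_trans lgt)// /rhs uxE lerD2l ler_pM2l//.
apply: le_trans (max_on_ge ps _) => [|r /andP[pr rs]]; last first.
  have T0r := le_trans T0p pr.
  by rewrite x_gt0//= x_le.
apply: g_ndecr; [exact: u_gt0| |exact: x_le].
by rewrite -subr_ge0 zge// T0p.
Qed.

End Comparison.

Section Halving.
Context {R : realType} (g : R -> R) (p d : R).
Hypothesis d_gt0 : 0 < d.
Hypothesis p_ge0 : 0 <= p.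
Hypothesis g_ndecr : forall y z, 0 < y -> y <= z -> z <= d -> g y <= g z.
Hypothesis g_gt0 : forall y, 0 < y <= d -> 0 < g y.

(** Induction on the number of doublings that bring y into [d/2, d]. *)
Let halving_ind (P : R -> Prop) :
  (forall y, d / 2 <= y -> y <= d -> P y) ->
  (forall y, 0 < y -> 2 * y <= d -> P (2 * y) -> P y) ->
  forall y, 0 < y <= d -> P y.
Proof.
move=> P0 P2 y /andP[y0 yd].
have : d / y <= 2 ^+ Num.bound (d / y) by apply/ltW/upper_nthrootP.
move: (Num.bound _) => n; rewrite ler_pdivrMr// => ny.
elim: n y y0 yd ny => [|n IH] y y0 yd ny.
  by apply: P0 => //; move: ny d_gt0; rewrite expr0; lra.
have [dy|yd2] := leP (d / 2) y; first exact: P0.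
apply: P2 => //; first lra.
by apply: IH; [lra|lra|rewrite mulrA -exprSr].
Qed.

(** Potter-type bound: a doubling inequality with exponent p iterates to a global
    power bound, and monotonicity fills the dyadic gaps. *)
Lemma powR_le_halving :
  (forall y, 0 < y -> 2 * y <= d -> g (2 * y) <= 2 `^ p * g y) ->
  exists2 c, 0 < c & forall y, 0 < y <= d -> c * y `^ p <= g y.
Proof.
move=> gh; have d2 : 0 < d / 2 <= d by move: d_gt0; lra.
exists (g (d / 2) / d `^ p); first by rewrite divr_gt0 ?powR_gt0// g_gt0.
apply: halving_ind => [y dy yd|y y0 yd IH].
  rewrite mulrAC ler_pdivrMr ?powR_gt0// ler_pM//.
  - by rewrite ltW// g_gt0.
  - exact: powR_ge0.
  - by apply: g_ndecr => //; case/andP: d2.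
  - by rewrite ge0_ler_powR// nnegrE; move: d_gt0; lra.
have := le_trans IH (gh _ y0 yd).
have -> : (2 * y) `^ p = 2 `^ p * y `^ p by rewrite powRM// ltW.
by rewrite mulrCA ler_pM2l// powR_gt0.
Qed.

Lemma halving_le_powR :
  (forall y, 0 < y -> 2 * y <= d -> 2 `^ p * g y <= g (2 * y)) ->
  exists2 c, 0 < c & forall y, 0 < y <= d -> g y <= c * y `^ p.
Proof.
move=> gh; have d2 : 0 < d / 2 <= d by move: d_gt0; lra.
have d20 : 0 < d / 2 by case/andP: d2.
exists (g d / (d / 2) `^ p).
  by rewrite divr_gt0 ?powR_gt0// g_gt0// d_gt0/=.
apply: halving_ind => [y dy yd|y y0 yd IH].
  rewrite mulrAC ler_pdivlMr ?powR_gt0// ler_pM//.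
  - by rewrite ltW// g_gt0//; move: d_gt0; lra.
  - exact: powR_ge0.
  - by apply: g_ndecr => //; move: d_gt0; lra.
  - by rewrite ge0_ler_powR// nnegrE; move: d_gt0; lra.
have := le_trans (gh _ y0 yd) IH.
have -> : (2 * y) `^ p = 2 `^ p * y `^ p by rewrite powRM// ltW.
by rewrite [leRHS]mulrCA ler_pM2l// powR_gt0.
Qed.

End Halving.

(** * Primitives, and regular variation of g *)

Section Primitive.
Context {R : realType}.
Notation mu := (@lebesgue_measure R).
Implicit Types f F : R -> R.

Lemma is_deriveCM F (c t l : R) :
  is_derive t 1 F l -> is_derive t 1 (fun z => c * F z) (c * l).
Proof. by move=> Fl; apply: is_deriveZ. Qed.

Lemma is_derive_dilate F (k t l : R) :
  is_derive (k * t) 1 F l -> is_derive t 1 (fun z => F (k * z)) (k * l).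
Proof.
move=> Fl; have kid : is_derive t 1 (fun z : R => k * z) k.
  by have := is_deriveCM k (is_derive_id t (1 : R)); rewrite mulr1.
by have := is_derive1_comp Fl kid; rewrite mulrC.
Qed.

Lemma integrable_itv_continuous f (c d : R) :
  (forall y, c <= y <= d -> {for y, continuous f}) ->
  mu.-integrable `[c, d] (EFin \o f).
Proof.
move=> fc; apply: continuous_compact_integrable; first exact: segment_compact.
apply: continuous_in_subspaceT => u /[!inE]/=; rewrite in_itv/=; exact: fc.
Qed.

Lemma Rintegral_chasles f (c d e : R) : c <= d -> d <= e ->
  mu.-integrable `[c, e] (EFin \o f) ->
  \int[mu]_(t in `[c, e]) f t = \int[mu]_(t in `[c, d]) f t + \int[mu]_(t in `[d, e]) f t.
Proof.
move=> cd de fi.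
have /(_ _ _)/eqP := @Rintegral_itvB R f (BLeft c) (BRight e) d fi.
rewrite !bnd_simp => /(_ cd de); rewrite subr_eq addrC => /eqP ->.
rewrite Rintegral_itv_obnd_cbnd//.
by apply: integrableS fi => //; apply: subset_itvr; rewrite bnd_simp.
Qed.

Lemma is_derive_primitive f (c y : R) : c < y ->
  (forall t, c <= t -> {for t, continuous f}) ->
  is_derive y 1 (fun z => \int[mu]_(t in `[c, z]) f t) (f y).
Proof.
move=> cy fc.
have fi : mu.-integrable `[c, y + 1] (EFin \o f).
  by apply: integrable_itv_continuous => t /andP[ct _]; exact: fc.
have yy : y < y + 1 by rewrite ltrDl.
have [dF F'] := continuous_FTC1_closed yy fi cy (fc _ (ltW cy)).
by apply: DeriveDef => //; rewrite -derive1E.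
Qed.

End Primitive.

Section RegularVariation.
Context {R : realType}.
Implicit Types (f F : R -> R).

(** The Cauchy mean value theorem in additive form.  Being additive, it serves
    both primitives vanishing at 0 (let y tend to 0) and primitives infinite
    at 0 (fix z). *)
Lemma dilate_increment_le F f (k l e y z : R) : 0 < k -> 0 < y -> y <= z ->
  (forall t, 0 < t -> t <= z \/ t <= k * z -> is_derive t 1 F (f t)) ->
  (forall t, 0 < t <= z -> `|k * f (k * t) - l * f t| <= e * f t) ->
  `|(F (k * z) - l * F z) - (F (k * y) - l * F y)| <= e * (F z - F y).
Proof.
move=> k0 y0 yz Ff H.
(* The absolute value is the pair of inequalities with s = 1 and s = -1. *)
suff key s : `|s| <= 1 ->
    s * ((F (k * z) - l * F z) - (F (k * y) - l * F y)) <= e * (F z - F y).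
  rewrite ler_norml; apply/andP; split.
    by have := key (-1); rewrite normrN normr1 lexx => /(_ isT); lra.
  by have := key 1; rewrite normr1 lexx => /(_ isT); lra.
move=> s1.
have : e * F y - s * (F (k * y) - l * F y) <= e * F z - s * (F (k * z) - l * F z).
  apply: (@is_derive_ndecr _ (fun t => e * F t - s * (F (k * t) - l * F t))
    (fun t => e * f t - s * (k * f (k * t) - l * f t))) => // t /andP[yt tz].
  - have t0 := lt_le_trans y0 yt.
    have Ft : is_derive t 1 F (f t) by apply: Ff => //; left.
    have Fkt : is_derive t 1 (fun t => F (k * t)) (k * f (k * t)).
      apply: is_derive_dilate; apply: Ff; first exact: mulr_gt0.
      by right; rewrite ler_pM2l.
    exact: (is_deriveB (is_deriveCM e Ft) (is_deriveCM s (is_deriveB Fkt (is_deriveCM l Ft)))).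
  - have := H t; rewrite (lt_le_trans y0 yt) tz => /(_ isT) Ht.
    rewrite subr_ge0 (le_trans (ler_norm _))// normrM (le_trans _ Ht)//.
    by rewrite ler_piMl.
lra.
Qed.

End RegularVariation.

Section Nonlinearity.
Context {R : realType} (g : R -> R) (beta : R).
Hypothesis g_cont : {within `[0, +oo[, continuous g}.
Hypothesis g0 : g 0 = 0.
Hypothesis g_gt0 : forall y : R, 0 < y -> 0 < g y.
Hypothesis g_C1 : exists2 delta1 : R, 0 < delta1 &
       forall y : R, 0 < y < delta1 -> derivable g y 1 /\ 0 < derive1 g y.
Hypothesis beta_gt1 : 1 < beta.
Hypothesis g'_RV : RV0 (beta - 1) (derive1 g).

Lemma g_continuous_at (y : R) : 0 < y -> {for y, continuous g}.
Proof.
move=> y0; have /continuous_within_itvcyP[+ _] := g_cont.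
by apply; rewrite in_itv/= y0.
Qed.

Lemma g_cvg0 : g y @[y --> 0^'+] --> 0.
Proof. by have /continuous_within_itvcyP[_] := g_cont; rewrite g0. Qed.

Lemma cvg_dilate0 (k : R) : 0 < k -> k * y @[y --> 0^'+] --> 0^'+.
Proof.
move=> k0 P /near_at_right0P[d d0 H]; apply/near_at_right0P.
exists (d / k); first exact: divr_gt0.
move=> t /andP[t0 td]; apply: H; rewrite mulr_gt0//=.
by rewrite mulrC -ler_pdivlMr.
Qed.

Lemma g_is_derive : exists2 d, 0 < d &
  forall y : R, 0 < y <= d -> is_derive y 1 g (derive1 g y) /\ 0 < derive1 g y.
Proof.
have [d d0 H] := g_C1; exists (d / 2); first by rewrite divr_gt0.
move=> y /andP[y0 yd]; have [|gd g'0] := H y; first by rewrite y0; lra.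
by split => //; rewrite derive1E; apply: derivableP.
Qed.

Lemma g_ndecr_near0 : exists2 d, 0 < d &
  forall y z, 0 < y -> y <= z -> z <= d -> g y <= g z.
Proof.
have [d d0 H] := g_is_derive; exists d => // y z y0 yz zd.
have H' u : y <= u <= z -> 0 < u <= d.
  by move=> /andP[yu uz]; rewrite (lt_le_trans y0 yu) (le_trans uz zd).
by apply: (@is_derive_ndecr _ _ (derive1 g)) => // u /H'/H[] // _ /ltW.
Qed.

(** Integrate k g'(k t) ~ k^beta g'(t) from 0, where g vanishes. *)
Lemma g_RV_of_derive (k : R) : 0 < k -> g (k * y) / g y @[y --> 0^'+] --> k `^ beta.
Proof.
move=> k0; apply/cvg_ratioP => [|e e0].
  by apply/near_at_right0P; exists 1 => // t /andP[t0 _]; exact: g_gt0.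
have [d d0 gd] := g_is_derive.
have /(_ _ _ (divr_gt0 e0 k0))/near_at_right0P[d' d'0 Hd'] :=
  (cvg_ratioP _ _ g'_RV.1).1 (g'_RV.2 _ k0).
apply/near_at_right0P; exists (Num.min d' (Num.min d (d / k))).
  by rewrite !lt_min d0 d'0 divr_gt0.
move=> z /andP[z0]; rewrite !le_min => /and3P[zd' zd zdk].
have kE : k * k `^ (beta - 1) = k `^ beta.
  by rewrite mulr_powRB1 ?(ltW k0)//; move: beta_gt1; lra.
have inc y : 0 < y <= z ->
   `|(g (k * z) - k `^ beta * g z) - (g (k * y) - k `^ beta * g y)| <= e * (g z - g y).
  move=> /andP[y0 yz].
  apply: (@dilate_increment_le _ _ (derive1 g)) => // [t t0 tz|t /andP[t0 tz]].
    apply: (gd _ _).1; rewrite t0/=; case: tz => [/le_trans->//|/le_trans]; apply.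
    by rewrite mulrC -ler_pdivlMr.
  have := Hd' t; rewrite t0 (le_trans tz zd') => /(_ isT).
  rewrite -kE -mulrA -mulrBr normrM gtr0_norm// -ler_pdivlMl//.
  by rewrite mulrA [k^-1 * _]mulrC.
have gk0 : g (k * y) @[y --> 0^'+] --> 0 by apply: cvg_comp g_cvg0; exact: cvg_dilate0.
rewrite -subr_le0.
have : `|(g (k * z) - k `^ beta * g z) - (g (k * y) - k `^ beta * g y)|
   - e * (g z - g y) @[y --> 0^'+] -->
   `|(g (k * z) - k `^ beta * g z) - (0 - k `^ beta * 0)| - e * (g z - 0).
  apply: cvgB; last by apply: cvgMr; apply: cvgB; [exact: cvg_cst|exact: g_cvg0].
  apply: cvg_norm; apply: cvgB; first exact: cvg_cst.
  by apply: cvgB => //; apply: cvgMr; exact: g_cvg0.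
rewrite !mulr0 !subr0; move=> /cvgr_to_le; apply.
apply/near_at_right0P; exists z => // y yz.
by rewrite subr_le0 inc.
Qed.
End Nonlinearity.

(** * Regular variation of G and of its inverse *)

Section Powers.
Context {R : realType}.
Implicit Types a p q l : R.

Lemma powR_lt_exponent a p q : 1 < a -> p < q -> a `^ p < a `^ q.
Proof.
move=> a1 pq; have a0 : 0 < a by rewrite (lt_trans _ a1).
by rewrite /powR gt_eqF// ltr_expR ltr_pM2r// ln_gt0.
Qed.

Lemma cvg_pos_bounds {T : Type} {F : set_system T} {FF : Filter F} (f : T -> R) l :
  0 < l ->
  (forall A, l < A -> \forall t \near F, f t <= A) ->
  (forall A, 0 < A < l -> \forall t \near F, A <= f t) ->
  f t @[t --> F] --> l.
Proof.
move=> l0 Hu Hl; apply/cvgrPdist_le => e e0.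
have lA : l < l + e by rewrite ltrDl.
pose A := Num.max (l / 2) (l - e).
have A0 : 0 < A < l by rewrite lt_max gt_max; apply/andP; split; lra.
have := Hl _ A0; apply: filterS2 (Hu _ lA) => t tu tl.
have : l - e <= A by rewrite le_max lexx orbT.
rewrite ler_distlC => h; apply/andP; split; lra.
Qed.

End Powers.

Section InverseOfG.
Context {R : realType} (g : R -> R) (beta : R).
Hypothesis g_gt0 : forall y : R, 0 < y -> 0 < g y.
Hypothesis g_cont : forall y : R, 0 < y -> {for y, continuous g}.
Hypothesis g_ndecr : exists2 d, 0 < d &
  forall y z, 0 < y -> y <= z -> z <= d -> g y <= g z.
Hypothesis beta_gt1 : 1 < beta.
Hypothesis g_RV : forall k : R, 0 < k -> g (k * y) / g y @[y --> 0^'+] --> k `^ beta.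
Notation mu := (@lebesgue_measure R).
Notation G := (G g).
Notation Gam := (Ginv g).

(** Doubling multiplies g by about 2^beta, which is less than 2^p. *)
Lemma g_ge_powR (p : R) : beta < p -> exists2 d, 0 < d &
  exists2 c, 0 < c & forall y, 0 < y <= d -> c * y `^ p <= g y.
Proof.
move=> pb; have [d d0 gmon] := g_ndecr.
have lt2 : (2 : R) `^ beta < 2 `^ p by apply: powR_lt_exponent => //; lra.
have /near_at_right0P[d' d'0 H] : \forall y \near 0^'+, g (2 * y) / g y < 2 `^ p.
  exact: cvgr_lt (g_RV (ltr0Sn R 1)) _ lt2.
have m0 : 0 < Num.min d d' by rewrite lt_min d0 d'0.
exists (Num.min d d') => //.
apply: powR_le_halving => //.
- by move: beta_gt1; lra.
- by move=> y z y0 yz; rewrite le_min => /andP[zd _]; exact: gmon.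
- by move=> y /andP[y0 _]; exact: g_gt0.
- move=> y y0; rewrite le_min => /andP[_ yd'].
  rewrite -ler_pdivrMr ?g_gt0//; apply/ltW/H; rewrite y0; lra.
Qed.

(** Doubling multiplies g by about 2^beta > 2; the linear bound makes 1/g
    non-integrable at 0. *)
Lemma g_le_linear : exists2 d, 0 < d &
  exists2 c, 0 < c & forall y, 0 < y <= d -> g y <= c * y.
Proof.
have [d d0 gmon] := g_ndecr.
have lt2 : (2 : R) `^ 1 < 2 `^ beta by apply: powR_lt_exponent => //; lra.
have /near_at_right0P[d' d'0 H] : \forall y \near 0^'+, 2 `^ 1 < g (2 * y) / g y.
  exact: cvgr_gt (g_RV (ltr0Sn R 1)) _ lt2.
have m0 : 0 < Num.min d d' by rewrite lt_min d0 d'0.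
exists (Num.min d d') => //.
have [||||c c0 Hc] := @halving_le_powR R g 1 (Num.min d d') m0.
- exact: ler01.
- by move=> y z y0 yz; rewrite le_min => /andP[zd _]; exact: gmon.
- by move=> y /andP[y0 _]; exact: g_gt0.
- move=> y y0; rewrite le_min => /andP[_ yd'].
  rewrite -ler_pdivlMr ?g_gt0//; apply/ltW/H; rewrite y0; lra.
- by exists c => // y yd; have := Hc _ yd; case/andP: yd => y0 _; rewrite powRr1// ltW.
Qed.

Lemma invg_cont (y : R) : 0 < y -> {for y, continuous (fun u => (g u)^-1)}.
Proof. by move=> y0; apply: cvgV; [rewrite gt_eqF ?g_gt0|exact: g_cont]. Qed.

(** A base point c below z replaces the two oriented cases in the definition of G
    by a single primitive, to which the fundamental theorem applies, also
    across z = 1. *)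
Lemma GE (c z : R) : 0 < c <= 1 -> c <= z ->
  G z = \int[mu]_(u in `[c, 1]) (g u)^-1 - \int[mu]_(u in `[c, z]) (g u)^-1.
Proof.
move=> /andP[c0 c1] cz.
have gi d : mu.-integrable `[c, d] (EFin \o (fun u => (g u)^-1)).
  apply: integrable_itv_continuous => y /andP[cy _].
  by apply: invg_cont; exact: lt_le_trans cy.
rewrite /Defs.G; case: leP => [z1|/ltW z1].
  by rewrite (Rintegral_chasles cz z1)// addrC addKr.
by rewrite (Rintegral_chasles c1 z1)// opprD addrA subrr sub0r.
Qed.

Lemma is_derive_G (y : R) : 0 < y -> is_derive y 1 G (- (g y)^-1).
Proof.
move=> y0; pose c := Num.min y 1 / 2.
have m0 : 0 < Num.min y 1 by rewrite lt_min y0 ltr01.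
have c0 : 0 < c by rewrite divr_gt0.
have cm : c < Num.min y 1 by rewrite ltr_pdivrMr// mulr_natr mulr2n ltrDl.
have /andP[cy /ltW c1] : (c < y) && (c < 1) by rewrite -lt_min.
pose C := \int[mu]_(u in `[c, 1]) (g u)^-1.
apply: (@near_eq_is_derive _ _ _ (fun z => C - \int[mu]_(u in `[c, z]) (g u)^-1)).
  near=> z; rewrite (@GE c)// ?c0//.
  by apply: ltW; near: z; exact: lt_nbhsr.
have prim : is_derive y 1 (fun z => \int[mu]_(u in `[c, z]) (g u)^-1) (g y)^-1.
  apply: (is_derive_primitive (f := fun u => (g u)^-1)) => // t ct.
  by apply: invg_cont; exact: lt_le_trans ct.
by have := is_deriveB (is_derive_cst C y 1) prim; rewrite sub0r.
Unshelve. all: by end_near. Qed.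

Lemma G_decr (y z : R) : 0 < y -> y < z -> G z < G y.
Proof.
move=> y0 yz; rewrite -ltrN2.
apply: (@is_derive_lt _ (fun u => - G u) (fun u => (g u)^-1)) => // u /andP[yu _];
  have u0 := lt_le_trans y0 yu.
- by have := is_deriveN (is_derive_G u0); rewrite opprK.
- by rewrite invr_gt0 g_gt0.
Qed.

Lemma G_lt (y z : R) : 0 < y -> 0 < z -> (G z < G y) = (y < z).
Proof.
move=> y0 z0; case: (ltgtP y z) => [|zy|->]; first exact: G_decr.
  by apply/negbTE; rewrite -leNgt ltW// G_decr.
by rewrite ltxx.
Qed.

Lemma G1 : G 1 = 0.
Proof. by rewrite /Defs.G lexx set_itv1 Rintegral_set1. Qed.

Lemma G_infty : G y @[y --> 0^'+] --> +oo.
Proof.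
have [d d0 [c c0 gc]] := g_le_linear.
apply/cvgryPge => A; apply/near_at_right0P.
pose K := c * (A - G d - c^-1 * ln d).
exists (Num.min d (expR (- K))); first by rewrite lt_min d0 expR_gt0.
move=> y /andP[y0]; rewrite le_min => /andP[yd yK].
have : - G y + c^-1 * - ln y <= - G d + c^-1 * - ln d.
  apply: (@is_derive_ndecr _ (fun z => - G z + c^-1 * - ln z)
    (fun z => (g z)^-1 + c^-1 * - z^-1)) => // u /andP[yu ud];
    have u0 := lt_le_trans y0 yu.
  - apply: is_deriveD.
      by have := is_deriveN (is_derive_G u0); rewrite opprK.
    by apply: is_deriveCM; apply: is_deriveN; exact: is_derive1_ln.
  - rewrite mulrN subr_ge0 -invfM lef_pV2 ?posrE ?mulr_gt0 ?g_gt0//.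
    by apply: gc; rewrite u0.
have lnyK : ln y <= - K by rewrite -[- K]expRK ler_ln ?posrE ?expR_gt0.
have : c^-1 * ln y <= - (A - G d - c^-1 * ln d).
  rewrite -[X in _ <= - X](mulKf (lt0r_neq0 c0)) -/K -mulrN ler_pM2l//.
  by rewrite invr_gt0.
lra.
Qed.

Lemma GamK (y : R) : 0 < y -> Gam (G y) = y.
Proof.
move=> y0; rewrite /Ginv pinvKV ?inE/= ?in_itv/= ?y0//.
move=> u v; rewrite !inE/= !in_itv/= !andbT => u0 v0 /eqP E; apply/eqP; move: E.
by apply: contraTT; rewrite !neq_lt => /orP[] h; apply/orP; [right|left]; exact: G_decr.
Qed.

Lemma G_surj (s : R) : 0 <= s -> exists2 y, 0 < y <= 1 & G y = s.
Proof.
move=> s0.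
have /cvgryPge := G_infty; move=> /(_ s)/near_at_right0P[d d0 Hd].
pose y := Num.min d 1.
have y0 : 0 < y by rewrite lt_min d0 ltr01.
have y1 : y <= 1 by rewrite ge_min lexx orbT.
have Gys : s <= G y by apply: Hd; rewrite y0 ge_min lexx.
have [||c /[!in_itv]/= /andP[yc c1] <-] := @IVT _ G y 1 s y1.
- apply: continuous_in_subspaceT => u /[!inE]/=; rewrite in_itv/= => /andP[yu _].
  by apply: is_derive_continuous (is_derive_G _); exact: lt_le_trans yu.
- by rewrite G1 ge_min le_max s0 Gys orbT.
by exists c => //; rewrite c1 (lt_le_trans y0).
Qed.

Lemma Gam_gt0 (s : R) : 0 <= s -> 0 < Gam s.
Proof. by move=> /G_surj[y /andP[y0 _] <-]; rewrite GamK. Qed.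

Lemma GGamK (s : R) : 0 <= s -> G (Gam s) = s.
Proof. by move=> /G_surj[y /andP[y0 _] <-]; rewrite GamK. Qed.

Lemma Gam_lt (s t : R) : 0 <= s -> 0 <= t -> (Gam t < Gam s) = (s < t).
Proof.
by move=> s0 t0; rewrite -G_lt ?Gam_gt0// !GGamK.
Qed.

Lemma Gam_le (s t : R) : 0 <= s -> 0 <= t -> (Gam t <= Gam s) = (s <= t).
Proof. by move=> s0 t0; rewrite leNgt Gam_lt// -leNgt. Qed.

Lemma is_derive_Gam (s : R) : 0 < s -> is_derive s 1 Gam (- g (Gam s)).
Proof.
move=> s0; have y0 := Gam_gt0 (ltW s0).
have : is_derive (G (Gam s)) 1 Gam (- (g (Gam s))^-1)^-1.
  apply: is_derive_inverse; [| |exact: is_derive_G|].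
  - near=> y; apply: GamK; near: y; exact: lt_nbhsr.
  - near=> y; apply: is_derive_continuous (is_derive_G _); near: y; exact: lt_nbhsr.
  - by rewrite oppr_eq0 invr_eq0 gt_eqF// g_gt0.
by rewrite GGamK ?(ltW s0)// invrN invrK.
Unshelve. all: by end_near. Qed.

Lemma Gam_cvg0 : Gam s @[s --> +oo] --> 0^'+.
Proof.
move=> P /near_at_right0P[d d0 H]; apply/near_pinftyP.
exists (Num.max 1 (G d)); first by rewrite lt_max ltr01.
move=> s; rewrite ge_max => /andP[s1 Gs]; have s0 : 0 <= s by rewrite (le_trans _ s1).
apply: H; rewrite Gam_gt0//= leNgt -G_lt ?Gam_gt0// GGamK//.
by rewrite -leNgt.
Qed.

(** Integrate k / g(k t) ~ k^(1-beta) / g(t) up to a fixed d; the contribution of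
    d is bounded while G is infinite at 0. *)
Lemma G_RV (k : R) : 0 < k -> G (k * y) / G y @[y --> 0^'+] --> k `^ (1 - beta).
Proof.
move=> k0; apply: cvg_ratio_infty; first exact: G_infty.
move=> e e0.
have ig : (g (k * y))^-1 / (g y)^-1 @[y --> 0^'+] --> k `^ (- beta).
  have E : (fun y => (g (k * y))^-1 / (g y)^-1) = (fun y => (g (k * y) / g y)^-1).
    by apply/funext => y; rewrite invf_div invrK mulrC.
  rewrite E powRN; apply: cvgV; last exact: g_RV.
  by rewrite gt_eqF// powR_gt0.
have ipos : \forall y \near 0^'+, 0 < (g y)^-1.
  by apply/near_at_right0P; exists 1 => // y /andP[y0 _]; rewrite invr_gt0 g_gt0.
have /(_ _ _ (divr_gt0 e0 k0))/near_at_right0P[d d0 Hd] := (cvg_ratioP _ _ ipos).1 ig.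
pose l := k `^ (1 - beta).
exists (`|G (k * d) - l * G d| - e * G d); apply/near_at_right0P; exists d => // y /andP[y0 yd].
have kl : k * k `^ (- beta) = l.
  by rewrite /l powRD ?powRr1 ?(ltW k0)// (gt_eqF k0) implybT.
have inc : `|(- G (k * d) - l * - G d) - (- G (k * y) - l * - G y)| <= e * (- G d - - G y).
  apply: (@dilate_increment_le R (fun z => - G z) (fun z => (g z)^-1)) => // t.
    by move=> t0 _; have := is_deriveN (is_derive_G t0); rewrite opprK.
  move=> td; have := Hd _ td; rewrite -(ler_pM2l k0).
  rewrite -[X in X * `|_|](gtr0_norm k0) -normrM mulrBr !mulrA kl.
  by rewrite [k * e]mulrC mulfK// gt_eqF.
have := ler_normD (G (k * d) - l * G d) ((G (k * y) - l * G y) - (G (k * d) - l * G d)).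
rewrite [_ + (_ - (G (k * d) - l * G d))]addrC subrK => /le_trans; apply.
move: inc; rewrite (_ : (- G (k * d) - l * - G d) - _ =
  (G (k * y) - l * G y) - (G (k * d) - l * G d)); last by ring.
lra.
Qed.

(** G(A y) < c G y with y = G^-1(s) reads G^-1(c s) < A G^-1(s); it holds for small
    y as soon as A^(1-beta) < c. *)
Lemma Gam_RV (c : R) : 0 < c ->
  Gam (c * s) / Gam s @[s --> +oo] --> c `^ (- (beta - 1)^-1).
Proof.
move=> c0; set l := c `^ _; have l0 : 0 < l by exact: powR_gt0.
have b1 : beta - 1 != 0 by move: beta_gt1 => ?; apply/eqP; lra.
have lE : l `^ (1 - beta) = c.
  by rewrite /l -powRrM mulNr -mulrN opprB mulVf ?powRr1 ?(ltW c0).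
have powR_anti A B : 0 < A -> A < B -> B `^ (1 - beta) < A `^ (1 - beta).
  move=> A0 AB; have B0 := lt_trans A0 AB.
  rewrite -opprB !powRN ltf_pV2 ?posrE ?powR_gt0// gt0_ltr_powR ?nnegrE ?(ltW A0) ?(ltW B0)//.
  by move: beta_gt1; lra.
apply: cvg_pos_bounds => // [A lA|A /andP[A0 Al]].
- have A0 := lt_trans l0 lA.
  have := powR_anti _ _ l0 lA; rewrite lE => h; have /Gam_cvg0 : \forall y \near 0^'+, G (A * y) / G y < c.
    exact: cvgr_lt (G_RV A0) _ h.
  move/near_pinftyP => [T T0 HT]; apply/near_pinftyP; exists T => // s Ts.
  have s0 := lt_le_trans T0 Ts; have y0 := Gam_gt0 (ltW s0).
  have /= := HT _ Ts; rewrite GGamK ?(ltW s0)// ltr_pdivrMr//.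
  have cs0 : 0 <= c * s by rewrite mulr_ge0 ?(ltW c0) ?(ltW s0).
  rewrite -{1}[c * s]GGamK// G_lt ?Gam_gt0 ?mulr_gt0// => h'.
  by rewrite ler_pdivrMr// ltW.
- have := powR_anti _ _ A0 Al; rewrite lE => h; have /Gam_cvg0 : \forall y \near 0^'+, c < G (A * y) / G y.
    exact: cvgr_gt (G_RV A0) _ h.
  move/near_pinftyP => [T T0 HT]; apply/near_pinftyP; exists T => // s Ts.
  have s0 := lt_le_trans T0 Ts; have y0 := Gam_gt0 (ltW s0).
  have /= := HT _ Ts; rewrite GGamK ?(ltW s0)// ltr_pdivlMr//.
  have cs0 : 0 <= c * s by rewrite mulr_ge0 ?(ltW c0) ?(ltW s0).
  rewrite -{1}[c * s]GGamK// G_lt ?Gam_gt0 ?mulr_gt0// => h'.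
  by rewrite ler_pdivlMr// ltW.
Qed.

(** G^-1(c s) lies between k G^-1(s) for constants k near the limit ratio, and g is
    monotone and regularly varying; k is obtained as a beta-th root. *)
Lemma gGam_RV (c : R) : 0 < c ->
  g (Gam (c * s)) / g (Gam s) @[s --> +oo] --> c `^ (- (beta / (beta - 1))).
Proof.
move=> c0; set l := c `^ (- (beta - 1)^-1); have l0 : 0 < l by exact: powR_gt0.
have beta0 : 0 < beta by rewrite (lt_trans ltr01).
have -> : c `^ (- (beta / (beta - 1))) = l `^ beta.
  by rewrite /l -powRrM mulNr [in RHS]mulrC.
have [d d0 gmon] := g_ndecr.
have small k : 0 < k -> \forall s \near +oo, k * Gam s <= d.
  move=> k0; suff /Gam_cvg0 : \forall y \near 0^'+, k * y <= d by [].
  apply/near_at_right0P; exists (d / k); first exact: divr_gt0.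
  by move=> y /andP[y0]; rewrite ler_pdivlMr// mulrC.
have pos : \forall s \near +oo, 0 < Gam s /\ 0 < Gam (c * s).
  apply/near_pinftyP; exists 1 => // s s1; have s0 : 0 <= s by rewrite (le_trans _ s1).
  by rewrite !Gam_gt0// mulr_ge0// ltW.
have root A : 0 < A -> exists2 k : R, 0 < k & k `^ beta = A.
  move=> A0; exists (A `^ beta^-1); first exact: powR_gt0.
  by rewrite -powRrM mulVf ?gt_eqF// powRr1// ltW.
have lt_root k k' : 0 <= k -> 0 <= k' -> k `^ beta < k' `^ beta -> k < k'.
  move=> k0 k'0; apply: contraTT; rewrite -!leNgt => h.
  by apply: ge0_ler_powR; rewrite ?nnegrE// ltW.
apply: cvg_pos_bounds => [|A lA|A /andP[A0 Al]]; first exact: powR_gt0.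
- pose B := (l `^ beta + A) / 2.
  have [k k0 kB] : exists2 k : R, 0 < k & k `^ beta = B.
    by apply: root; rewrite divr_gt0// addr_gt0 ?(lt_trans _ lA)// powR_gt0.
  have lk : l < k by apply: lt_root; rewrite ?(ltW l0) ?(ltW k0)// kB /B; lra.
  have kA : k `^ beta < A by rewrite kB /B; lra.
  have /Gam_cvg0 N3 : \forall y \near 0^'+, g (k * y) / g y < A.
    exact: cvgr_lt (g_RV k0) _ kA.
  have N2 : \forall s \near +oo, Gam (c * s) / Gam s < k.
    exact: cvgr_lt (Gam_RV c0) _ lk.
  have N1 := filterI pos (small _ k0).
  near=> s.
  have [[y0 y0'] h2] : (0 < Gam s /\ 0 < Gam (c * s)) /\ k * Gam s <= d by near: s; exact: N1.
  have h1 : Gam (c * s) / Gam s < k by near: s; exact: N2.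
  have h3 : g (k * Gam s) / g (Gam s) < A by near: s; exact: N3.
  move: h1 h3; rewrite ltr_pdivrMr// => h1 h3.
  rewrite ler_pdivrMr ?g_gt0//; move: h3; rewrite ltr_pdivrMr ?g_gt0// => /ltW; apply: le_trans.
  by apply: gmon => //; exact: ltW.
- pose B := (l `^ beta + A) / 2.
  have [k k0 kB] : exists2 k : R, 0 < k & k `^ beta = B.
    by apply: root; rewrite divr_gt0// addr_gt0 ?(lt_trans _ lA)// powR_gt0.
  have lk : k < l by apply: lt_root; rewrite ?(ltW l0) ?(ltW k0)// kB /B; lra.
  have kA : A < k `^ beta by rewrite kB /B; lra.
  have /Gam_cvg0 N3 : \forall y \near 0^'+, A < g (k * y) / g y.
    exact: cvgr_gt (g_RV k0) _ kA.
  have h4 : \forall s \near +oo, Gam (c * s) <= d.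
    have /Gam_cvg0/near_pinftyP[T T0 HT] : \forall y \near 0^'+, y <= d.
      by apply/near_at_right0P; exists d => // y /andP[].
    apply/near_pinftyP; exists (T / c); first exact: divr_gt0.
    by move=> s; rewrite ler_pdivrMr// mulrC => /HT.
  have N2 : \forall s \near +oo, k < Gam (c * s) / Gam s.
    exact: cvgr_gt (Gam_RV c0) _ lk.
  have N1 := filterI pos h4.
  near=> s.
  have [[y0 y0'] h2] : (0 < Gam s /\ 0 < Gam (c * s)) /\ Gam (c * s) <= d by near: s; exact: N1.
  have h1 : k < Gam (c * s) / Gam s by near: s; exact: N2.
  have h3 : A < g (k * Gam s) / g (Gam s) by near: s; exact: N3.
  move: h1 h3; rewrite ltr_pdivlMr// => h1 h3.
  rewrite ler_pdivlMr ?g_gt0//; move: h3; rewrite ltr_pdivlMr ?g_gt0// => /ltW /le_trans; apply.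
  by apply: gmon => //; [rewrite mulr_gt0|exact: ltW].
Unshelve. all: by end_near. Qed.

End InverseOfG.

(** * The clock S, integral of 1/sigma *)

Section Clock.
Context {R : realType} (tau sigma : R -> R).
Hypothesis tau_ge0 : forall t : R, 0 <= t -> 0 <= tau t.
Hypothesis tau_lim : t - tau t @[t --> +oo] --> +oo.
Hypothesis sigma_cont : {within `[- taubar tau, +oo[, continuous sigma}.
Hypothesis sigma_ge0 : forall t : R, - taubar tau <= t -> 0 <= sigma t.
Hypothesis sigma_int : forall u v : R, - taubar tau <= u -> u <= v ->
       (int_inv sigma u v < +oo)%E.
Hypothesis sigma_int_infty : int_inv sigma 0 t @[t --> +oo] --> +oo%E.
Hypothesis sigma_infty : sigma t @[t --> +oo] --> +oo.
Hypothesis sigma_delay : int_inv sigma (t - tau t) t @[t --> +oo] --> 1%:E.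
Notation mu := (@lebesgue_measure R).

Let S (t : R) : R := fine (int_inv sigma 0 t).

(** The infimum is at most 0 - tau 0 if there is a lower bound, and 0 by
    convention otherwise. *)
Lemma taubar_le0 : - taubar tau <= 0.
Proof.
rewrite /taubar opprK; set A := [set _ | _ in _].
have A0 : A (0 - tau 0) by exists 0 => //=; rewrite in_itv/= lexx.
have [Alb|nAlb] := pselect (has_lbound A).
  apply: le_trans (ge_inf Alb A0) _; rewrite sub0r oppr_le0; exact: tau_ge0.
by rewrite inf_out//; case.
Qed.

Let sigma_continuous (t : R) : 0 < t -> {for t, continuous sigma}.
Proof.
move=> t0; have /continuous_within_itvcyP[+ _] := sigma_cont.
by apply; rewrite in_itv/= andbT (le_lt_trans taubar_le0).
Qed.

(** The extended inverse is +oo where sigma vanishes and the measurable power of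
    exponent -1 elsewhere. *)
Lemma measurable_inv_sigma (u v : R) : 0 <= u ->
  measurable_fun `[u, v] (fun s => ((sigma s)%:E)^-1)%E.
Proof.
move=> u0.
pose k (y : R) : \bar R := if y == 0 then +oo%E else (y `^ (-1))%:E.
have mk : measurable_fun setT k.
  apply: measurable_fun_ifT => //.
    apply: (measurable_fun_bool true); rewrite (_ : _ @^-1` _ = [set 0]) ?setTI//.
    by apply/seteqP; split => [_ /eqP ->//|_ -> /=]; rewrite eqxx.
  apply/measurable_EFinP; exact: (@measurableT_comp _ _ _ _ _ _ (@powR R ^~ (-1))).
have sk s : (`[u, v]%classic : set R) s -> ((sigma s)%:E^-1)%E = k (sigma s).
  rewrite /= in_itv/= => /andP[us _].
  have s0 : - taubar tau <= s by rewrite (le_trans taubar_le0)// (le_trans u0).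
  by rewrite inver /k; case: eqP => // _; rewrite powR_inv1// sigma_ge0.
apply: (eq_measurable_fun (k \o sigma)) => [s|].
  by rewrite inE => /sk.
apply: measurableT_comp => //; apply: subspace_continuous_measurable_fun => //.
apply: continuous_subspaceW sigma_cont => s /=; rewrite !in_itv/= => /andP[us _].
by rewrite andbT (le_trans taubar_le0)// (le_trans u0).
Qed.

Lemma int_inv_chasles (u v w : R) : 0 <= u -> u <= v -> v <= w ->
  int_inv sigma u w = (int_inv sigma u v + int_inv sigma v w)%E.
Proof.
move=> u0 uv vw; rewrite /int_inv.
have E : `[u, w]%classic = `[u, v[%classic `|` `[v, w]%classic :> set R.
  by rewrite -itv_bndbnd_setU ?bnd_simp.
rewrite E.
rewrite ge0_integral_setU//=.
- rewrite integral_itv_bndo_bndc//.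
  apply: (measurable_funS _ _ (@measurable_inv_sigma u v u0)) => //.
  by apply: subset_itvl; rewrite bnd_simp.
- by rewrite -E; exact: measurable_inv_sigma.
- move=> s us'; have : (`[u, w]%classic : set R) s by rewrite E.
  rewrite /= in_itv/= => /andP[us _].
  rewrite inve_ge0 lee_fin sigma_ge0// (le_trans taubar_le0)//.
  exact: le_trans us.
- by apply/disj_setPS => y [/=]; rewrite !in_itv/= => /andP[_ yv] /andP[]; rewrite leNgt yv.
Qed.

Lemma int_inv_ge0 (u v : R) : 0 <= u -> (0 <= int_inv sigma u v)%E.
Proof.
move=> u0; apply: integral_ge0 => s /=; rewrite in_itv/= => /andP[us _].
by rewrite inve_ge0 lee_fin sigma_ge0// (le_trans taubar_le0)// (le_trans u0).
Qed.

Lemma int_inv_fin (u v : R) : 0 <= u -> u <= v -> int_inv sigma u v \is a fin_num.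
Proof.
move=> u0 uv; rewrite ge0_fin_numE ?int_inv_ge0//.
by apply: sigma_int => //; exact: le_trans taubar_le0 u0.
Qed.

Lemma clock_ge0 (t : R) : 0 <= S t.
Proof. by rewrite fine_ge0// int_inv_ge0. Qed.

Lemma int_inv_clock (s t : R) : 0 <= s -> s <= t ->
  int_inv sigma s t = (S t - S s)%:E.
Proof.
move=> s0 st; rewrite EFinB !fineK ?int_inv_fin// ?(le_trans s0)//.
rewrite (int_inv_chasles (lexx 0) s0 st) addeAC subee ?add0e// int_inv_fin//.
Qed.

Lemma is_derive_clock : exists2 T : R, 0 < T & forall t, T <= t ->
  0 < sigma t /\ is_derive t 1 S (sigma t)^-1.
Proof.
have /cvgryPgt := sigma_infty; move=> /(_ 0)/near_pinftyP[T T0 sig].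
exists (T + 1) => [|t Tt]; first by rewrite addr_gt0.
have Tt' : T < t by move: Tt; lra.
split; first exact: sig (ltW Tt').
have sigc (u : R) : T <= u -> {for u, continuous (fun s => (sigma s)^-1)}.
  move=> Tu; apply: cvgV; first by rewrite gt_eqF ?sig.
  by apply: sigma_continuous; exact: lt_le_trans Tu.
have := is_derive_primitive Tt' sigc.
move=> /(is_deriveD (is_derive_cst (S T) t 1)); rewrite add0r.
apply: near_eq_is_derive; near=> s.
have Ts : T <= s by apply: ltW; near: s; exact: lt_nbhsr.
rewrite /= -[S s](subrK (S T)) addrC; congr (_ + _).
rewrite -[RHS]/(fine (S s - S T)%:E) -int_inv_clock ?(ltW T0)//.
congr fine; apply: eq_integral => u; rewrite inE/= in_itv/= => /andP[Tu _].
by rewrite inver gt_eqF// sig.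
Unshelve. all: by end_near. Qed.

Lemma clock_infty : S t @[t --> +oo] --> +oo.
Proof.
apply/cvgryPge => A; have /cvgeyPge := sigma_int_infty.
move=> /(_ A)/near_pinftyP[T T0 HT]; apply/near_pinftyP; exists T => // t Tt.
by rewrite -lee_fin fineK ?HT// int_inv_fin// ltW// (lt_le_trans T0).
Qed.

Lemma clock_delay : S t - S (t - tau t) @[t --> +oo] --> (1 : R).
Proof.
have /fine_cvgP[_] := sigma_delay; apply: cvg_trans; apply: near_eq_cvg.
have /cvgryPge := tau_lim; move=> /(_ 0)/near_pinftyP[T T0 HT].
apply/near_pinftyP; exists T => // t Tt.
rewrite /= int_inv_clock ?HT//.
by rewrite lerBlDr lerDl tau_ge0// ltW// (lt_le_trans T0).
Qed.

End Clock.

(** * Asymptotics of the solution *)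

Section PowersContinuity.
Context {R : realType}.
Implicit Types r p : R.

Lemma powR_continuous r p : 0 < r -> {for r, continuous (fun y => y `^ p)}.
Proof. by move=> r0; exact: is_derive_continuous (is_derive1_powR p r0). Qed.

Lemma powR_exponent_continuous r p : 0 < r -> {for p, continuous (fun e => r `^ e)}.
Proof.
move=> r0.
have E : (fun e => r `^ e) = (fun e : R => expR (e * ln r)).
  by apply/funext => e; rewrite /powR gt_eqF.
rewrite E; apply: (@cvg_comp _ _ _ (fun e => e * ln r) expR); last exact: continuous_expR.
by apply: cvgMl; exact: cvg_id.
Qed.

Lemma near_point (P : R -> Prop) r : (\forall y \near r, P y) ->
  exists2 e, 0 < e & forall y, `|y - r| < e -> P y.
Proof. by move=> [e /= e0 H]; exists e => // y ye; apply: H; rewrite /= distrC. Qed.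

End PowersContinuity.

Section Solution.
Context {R : realType} (a b beta : R) (g tau x : R -> R).
Hypothesis b_gt0 : 0 < b.
Hypothesis g_gt0 : forall y : R, 0 < y -> 0 < g y.
Hypothesis g_cont : forall y : R, 0 < y -> {for y, continuous g}.
Hypothesis g_ndecr : exists2 d, 0 < d &
  forall y z, 0 < y -> y <= z -> z <= d -> g y <= g z.
Hypothesis beta_gt1 : 1 < beta.
Hypothesis g_RV : forall k : R, 0 < k -> g (k * y) / g y @[y --> 0^'+] --> k `^ beta.
Hypothesis tau_ge0 : forall t : R, 0 <= t -> 0 <= tau t.
Hypothesis tau_lim : t - tau t @[t --> +oo] --> +oo.
Hypothesis x_gt0 : forall t : R, 0 <= t -> 0 < x t.
Hypothesis x_deriv : forall t : R, 0 < t -> is_derive t 1 x (rhs a b g tau x t).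
Hypothesis x_lim : x t @[t --> +oo] --> 0.
Notation Gam := (Ginv g).

Lemma solution_min (T0 T : R) : 0 < T0 -> T0 <= T ->
  exists2 m, 0 < m & forall s, T0 <= s <= T -> m <= x s.
Proof.
move=> T00 T0T; have [|c /[!in_itv]/= /andP[Tc _] Hc] := @EVT_min _ x T0 T T0T.
  apply: continuous_in_subspaceT => u /[!inE]/=; rewrite in_itv/= => /andP[Tu _].
  by apply: is_derive_continuous (x_deriv _); exact: lt_le_trans Tu.
exists (x c); first by rewrite x_gt0// ltW// (lt_le_trans T00).
by move=> s sI; apply: Hc; rewrite in_itv.
Qed.

Lemma solution_small (d : R) : 0 < d -> exists2 T, 0 < T & forall t, T <= t -> x t < d.
Proof.
move=> d0; suff /near_pinftyP : \forall t \near +oo, x t < d by [].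
exact: cvgr_lt x_lim _ d0.
Qed.

Lemma delay_ge (T0 : R) : exists2 T, 0 < T &
  forall t, T <= t -> T0 <= t - tau t <= t.
Proof.
have /cvgryPge := tau_lim; move=> /(_ T0)/near_pinftyP[T T_gt0 HT].
exists T => // t Tt; rewrite HT// gerBl tau_ge0// ltW//.
exact: lt_le_trans Tt.
Qed.

Let Gpos := Gam_gt0 g_gt0 g_cont g_ndecr beta_gt1 g_RV.
Let Gle := Gam_le g_gt0 g_cont g_ndecr beta_gt1 g_RV.
Let Gpos0 := Gam_cvg0 g_gt0 g_cont g_ndecr beta_gt1 g_RV.

(** ** Delay proportional to time *)

Section SlowDelay.
Variable r : R.
Hypothesis r_gt0 : 0 < r.
Hypothesis delay_ratio : (t - tau t) / t @[t --> +oo] --> r.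
Let theta := beta / (beta - 1).
(** The slope of G o x: a trial y = K t turns the equation into K = Ks. *)
Let Ks := a - b * r `^ (- theta).
Hypothesis Ks_gt0 : 0 < Ks.

(** The comparison function is G^-1(w), w = K1 t + D t^(1-nu) with Ks < K1 < K:
    - w' >= K1;
    - the delayed value of w is at most rho w, with rho slightly above r;
    - D only serves to place G^-1(w) below x on [T0, T], and D t^(1-nu) is
      eventually absorbed in (K - K1) t. *)
Lemma solution_ge_Gam (K : R) : Ks < K -> exists2 T, 0 < T & forall t, T <= t -> Gam (K * t) <= x t.
Proof.
move=> KsK; pose K1 := (Ks + K) / 2.
have K10 : 0 < K1 by move: Ks_gt0; rewrite /K1; lra.
have K1K : K1 < K by rewrite /K1; lra.
have KsK1 : Ks < K1 by rewrite /K1; lra.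
have rth : (a - K1) / b < r `^ (- theta).
  by rewrite ltr_pdivrMr// [_ * b]mulrC; move: KsK1; rewrite /Ks; lra.
have [rho rrho Hrho] : exists2 rho, r < rho & (a - K1) / b < rho `^ (- theta).
  have /near_point[e e0 He] : \forall y \near r, (a - K1) / b < y `^ (- theta).
    exact: cvgr_gt (powR_continuous (p := - theta) r_gt0) _ rth.
  exists (r + e / 2); first by rewrite ltrDl divr_gt0.
  by apply: He; rewrite addrAC subrr add0r gtr0_norm; lra.
have rho0 : 0 < rho by rewrite (lt_trans r_gt0).
have [M M0 HM] : exists2 M, 0 < M & forall s, M <= s -> (a - K1) / b < g (Gam (rho * s)) / g (Gam s).
  suff /near_pinftyP : \forall s \near +oo, (a - K1) / b < g (Gam (rho * s)) / g (Gam s) by [].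
  exact: cvgr_gt (gGam_RV g_gt0 g_cont g_ndecr beta_gt1 g_RV rho0) _ Hrho.
pose r' := (r + rho) / 2.
have rr' : r < r' by rewrite /r'; lra.
have r'rho : r' < rho by rewrite /r'; lra.
have r'0 : 0 < r' by rewrite (lt_trans r_gt0).
have [nu /andP[nu0 nu1] Hnu] : exists2 nu, 0 < nu < 1 & r' `^ (1 - nu) <= rho.
  have h : r' `^ 1 < rho by rewrite powRr1// ltW.
  have /near_point[e e0 He] : \forall p \near (1 : R), r' `^ p < rho.
    exact: cvgr_lt (powR_exponent_continuous (p := 1) r'0) _ h.
  have m0 : 0 < Num.min e 1 by rewrite lt_min e0 ltr01.
  have me : Num.min e 1 <= e by rewrite ge_min lexx.
  have m1 : Num.min e 1 <= 1 by rewrite ge_min lexx orbT.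
  exists (Num.min e 1 / 2); first by apply/andP; split; lra.
  apply/ltW/He; rewrite addrAC subrr add0r normrN gtr0_norm; lra.
have [d d0 gmon] := g_ndecr.
have [T0 T00 HT0] := solution_small d0.
pose T0' := Num.max 1 T0.
have T0'1 : 1 <= T0' by rewrite le_max lexx.
have T0T0' : T0 <= T0' by rewrite le_max lexx orbT.
have T0'0 : 0 < T0' by rewrite (lt_le_trans ltr01).
have [T1 T10 HT1] := delay_ge T0'.
have [T2 T20 HT2] : exists2 T, 0 < T & forall t, T <= t -> (t - tau t) / t < r'.
  suff /near_pinftyP : \forall t \near +oo, (t - tau t) / t < r' by [].
  exact: cvgr_lt delay_ratio _ rr'.
have [T [TT1 TT2 TT0 TM]] := ubound4 T1 T2 T0' (M / K1).
have [xm xm0 Hxm] := solution_min T0'0 TT0.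
(* As T0' >= 1, this makes w exceed G xm from T0' on, that is G^-1(w) < xm. *)
pose D := `|G g xm| + 1.
have D0 : 0 < D by rewrite ltr_wpDl.
pose w (t : R) : R := K1 * t + D * t `^ (1 - nu).
have nu1' : 0 <= 1 - nu by lra.
have w_gt0 t : 0 < t -> 0 < w t.
  by move=> t0; rewrite addr_gt0// mulr_gt0// powR_gt0.
have w_mono s t : 0 < s -> s <= t -> w s <= w t.
  move=> s0 st; have t0 := lt_le_trans s0 st.
  rewrite lerD// ler_pM2l//; apply: ge0_ler_powR; rewrite ?nnegrE// ltW//.
have w_T0 : G g xm < w T0'.
  have pT : 1 <= T0' `^ (1 - nu).
    by rewrite -[leLHS](powRr0 T0'); apply: ler_powR.
  have : D <= D * T0' `^ (1 - nu) by rewrite ler_peMr// ltW.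
  have : 0 < K1 * T0' by rewrite mulr_gt0.
  have := ler_norm (G g xm); rewrite /w /D; lra.
have Gam_xm s : T0' <= s -> Gam (w s) < xm.
  move=> s0; have ws0 : 0 < w s by rewrite w_gt0// (lt_le_trans T0'0).
  rewrite -(G_lt g_gt0 g_cont) ?(Gam_gt0 g_gt0 g_cont g_ndecr beta_gt1 g_RV) ?(ltW ws0)//.
  rewrite (GGamK g_gt0 g_cont g_ndecr beta_gt1 g_RV) ?(ltW ws0)//.
  by rewrite (lt_le_trans w_T0)// w_mono.
have xmd : xm < d.
  by rewrite (le_lt_trans (Hxm T0' _)) ?lexx//= HT0.
have w_deriv (t : R) : 0 < t -> is_derive t 1 w (K1 + D * ((1 - nu) * t `^ (1 - nu - 1))).
  move=> t0; have h1 := is_deriveCM K1 (is_derive_id t (1 : R)).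
  have h2 := is_deriveCM D (is_derive1_powR (1 - nu) t0).
  by have := is_deriveD h1 h2; rewrite mulr1.
have u_deriv (t : R) : 0 < t -> is_derive t 1 (fun t => Gam (w t))
    (- g (Gam (w t)) * (K1 + D * ((1 - nu) * t `^ (1 - nu - 1)))).
  move=> t0; apply: (is_derive1_comp (f := Gam) (g := w)); last exact: w_deriv.
  exact: (is_derive_Gam g_gt0 g_cont g_ndecr beta_gt1 g_RV (w_gt0 t t0)).
have key : forall t, T0' <= t -> Gam (w t) < x t.
  apply: (@compare_below _ a b g tau x d b_gt0 gmon (fun t => Gam (w t)) T0' T) => //.
  - by move=> t Tt; apply: x_gt0; rewrite (le_trans _ Tt)// ltW.
  - by move=> t Tt; apply: x_deriv; exact: lt_le_trans Tt.
  - by move=> t Tt; apply: HT1; rewrite (le_trans TT1)// ltW.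
  - by move=> t Tt; apply: is_derive_continuous (u_deriv _ _); exact: lt_le_trans Tt.
  - by move=> t Tt; apply/ltW/HT0; exact: le_trans Tt.
  - move=> t Tt; apply: (Gam_gt0 g_gt0 g_cont g_ndecr beta_gt1 g_RV).
    by apply/ltW/w_gt0; exact: lt_le_trans Tt.
  - by move=> s /andP[T0s sT]; rewrite (lt_le_trans (Gam_xm _ T0s))// Hxm ?T0s.
  move=> t Tt; have t0 : 0 < t by rewrite (lt_trans _ Tt)// (lt_le_trans T0'0).
  have /andP[T0p pt] : T0' <= t - tau t <= t by apply: HT1; rewrite (le_trans TT1)// ltW.
  set p := t - tau t in T0p pt *.
  have p0 : 0 < p by rewrite (lt_le_trans T0'0).
  eexists; first exact: u_deriv.
  have wt0 := w_gt0 t t0; have wp0 := w_gt0 p p0.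
  have pr : p <= r' * t.
    by rewrite -ler_pdivrMr// ltW// HT2// (le_trans TT2)// ltW.
  have wpt : w p <= rho * w t.
    rewrite /w [in leRHS]mulrDr; apply: lerD.
      rewrite mulrCA ler_pM2l// (le_trans pr)// ler_pM2r// ltW//.
    rewrite mulrCA ler_pM2l//.
    apply: (@le_trans _ _ ((r' * t) `^ (1 - nu))).
      by apply: ge0_ler_powR; rewrite ?nnegrE// ltW// mulr_gt0.
    by rewrite powRM ?(ltW r'0) ?(ltW t0)// ler_pM2r// powR_gt0.
  have rw0 : 0 < rho * w t by rewrite mulr_gt0.
  have gle : g (Gam (rho * w t)) <= g (Gam (w p)).
    apply: gmon.
    - exact: (Gam_gt0 g_gt0 g_cont g_ndecr beta_gt1 g_RV (ltW rw0)).
    - by rewrite (Gam_le g_gt0 g_cont g_ndecr beta_gt1 g_RV) ?(ltW wp0) ?(ltW rw0).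
    - by apply/ltW/(lt_trans (Gam_xm _ T0p)).
  have gu0 : 0 < g (Gam (w t)).
    by apply: g_gt0; exact: (Gam_gt0 g_gt0 g_cont g_ndecr beta_gt1 g_RV (ltW wt0)).
  have : M <= w t.
    have : M <= K1 * t by rewrite mulrC -ler_pdivrMr// (le_trans TM)// ltW.
    by move=> /le_trans; apply; rewrite lerDl ltW// mulr_gt0// powR_gt0.
  move=> /HM; rewrite ltr_pdivlMr// -(ltr_pM2l b_gt0) mulrA [b * (_ / b)]mulrC divfK ?gt_eqF// => h.
  have h1 : b * g (Gam (rho * w t)) <= b * g (Gam (w p)) by rewrite ler_pM2l.
  have h2 : 0 <= g (Gam (w t)) * (D * ((1 - nu) * t `^ (1 - nu - 1))).
    by rewrite !mulr_ge0 ?powR_ge0// ltW.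
  lra.
pose C := D / (K - K1).
have C0 : 0 < C by rewrite divr_gt0// subr_gt0.
exists (Num.max T0' (C `^ nu^-1)) => [|t]; first by rewrite lt_max T0'0.
rewrite ge_max => /andP[Tt Ct]; have t0 := lt_le_trans T0'0 Tt.
apply/ltW/(le_lt_trans _ (key t Tt)).
have Kt0 : 0 <= K * t by rewrite mulr_ge0 ?ltW// (lt_trans _ KsK).
rewrite (Gam_le g_gt0 g_cont g_ndecr beta_gt1 g_RV)// ?(ltW (w_gt0 t t0))//.
have Cnu : C <= t `^ nu.
  rewrite -[C]powRr1 ?(ltW C0)// -(mulVf (lt0r_neq0 nu0)) powRrM.
  by apply: ge0_ler_powR; rewrite ?nnegrE ?powR_ge0 ?(ltW nu0) ?(ltW t0).
have E : t = t `^ (1 - nu) * t `^ nu.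
  by rewrite -powRD ?subrK ?powRr1 ?(ltW t0)// (gt_eqF t0) implybT.
have : D * t `^ (1 - nu) <= (K - K1) * t.
  rewrite [X in _ <= _ * X]E mulrCA [X in X <= _]mulrC ler_pM2l ?powR_gt0//.
  by rewrite mulrC -ler_pdivrMr ?subr_gt0.
rewrite /w; lra.
Qed.

Lemma delay_ratio_le1 : r <= 1.
Proof.
apply: (cvgr_to_le delay_ratio); apply/near_pinftyP; exists 1 => // t t1.
have t0 : 0 < t by rewrite (lt_le_trans ltr01).
by rewrite ler_pdivrMr// mul1r gerBl tau_ge0// ltW.
Qed.

(** The comparison function is G^-1(w), w = M + k1 / psi with
    1 / psi = t^(1+nu) / (t^nu + D) and k < k1 < Ks:
    - w' <= k1 (1+nu) <= k2 < Ks;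
    - the delayed value of w is at least rho w, with rho slightly below r;
    - w >= M keeps w where regular variation is effective, and for D large
      w <= 2 M on [T0, T], where G o x > 2 M already holds;
    - 1 / psi ~ t, so eventually w >= k t. *)
Lemma solution_le_Gam (k : R) : 0 < k -> k < Ks ->
  exists2 T, 0 < T & forall t, T <= t -> x t <= Gam (k * t).
Proof.
move=> k0 kKs.
pose k1 := (2 * k + Ks) / 3; pose k2 := (k + 2 * Ks) / 3.
have kk1 : k < k1 by rewrite /k1; lra.
have k12 : k1 < k2 by rewrite /k1 /k2; lra.
have k2Ks : k2 < Ks by rewrite /k2; lra.
have k10 : 0 < k1 by lra.
have rth : r `^ (- theta) < (a - k2) / b.
  by rewrite ltr_pdivlMr// [_ * b]mulrC; move: k2Ks; rewrite /Ks; lra.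
have [rho /andP[rho0 rhor] Hrho] : exists2 rho, 0 < rho < r & rho `^ (- theta) < (a - k2) / b.
  have /near_point[e e0 He] : \forall y \near r, y `^ (- theta) < (a - k2) / b.
    exact: cvgr_lt (powR_continuous (p := - theta) r_gt0) _ rth.
  have m0 : 0 < Num.min e r by rewrite lt_min e0 r_gt0.
  have me : Num.min e r <= e by rewrite ge_min lexx.
  have mr : Num.min e r <= r by rewrite ge_min lexx orbT.
  exists (r - Num.min e r / 2); first by apply/andP; split; lra.
  by apply: He; rewrite addrAC subrr add0r normrN gtr0_norm; lra.
have r1 := delay_ratio_le1.
have [d d0 gmon] := g_ndecr.
have [M0 M00 HM0] : exists2 M, 0 < M &
    forall s, M <= s -> g (Gam (rho * s)) / g (Gam s) < (a - k2) / b.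
  suff /near_pinftyP : \forall s \near +oo, g (Gam (rho * s)) / g (Gam s) < (a - k2) / b by [].
  exact: cvgr_lt (gGam_RV g_gt0 g_cont g_ndecr beta_gt1 g_RV rho0) _ Hrho.
have [M1 M10 HM1] : exists2 M, 0 < M & forall s, M <= s -> Gam s <= d.
  suff /Gpos0/near_pinftyP : \forall y \near 0^'+, y <= d by [].
  by apply/near_at_right0P; exists d => // y /andP[].
have [M [MM0 MM1 _ _]] := ubound4 M0 (M1 / rho) M0 M0.
have M_gt0 := lt_le_trans M00 MM0.
have HMd s : M <= s -> Gam (rho * s) <= d.
  by move=> Ms; apply: HM1; rewrite mulrC -ler_pdivrMr// (le_trans MM1).
pose r' := (r + rho) / 2.
have r'r : r' < r by rewrite /r'; lra.
have rhor' : rho < r' by rewrite /r'; lra.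
have r'0 : 0 < r' by rewrite (lt_trans rho0).
have r'1 : r' <= 1 by rewrite ltW// (lt_le_trans r'r).
have [nu nu0 [Hnu Hnuk]] : exists2 nu, 0 < nu & rho <= r' `^ (1 + nu) /\ k1 * (1 + nu) <= k2.
  have h : rho < r' `^ 1 by rewrite powRr1// ltW.
  have /near_point[e e0 He] : \forall p \near (1 : R), rho < r' `^ p.
    exact: cvgr_gt (powR_exponent_continuous (p := 1) r'0) _ h.
  pose m := Num.min e ((k2 - k1) / k1).
  have m0 : 0 < m by rewrite lt_min e0 divr_gt0// subr_gt0.
  have me : m <= e by rewrite ge_min lexx.
  have m1 : m * k1 <= k2 - k1 by rewrite -ler_pdivlMr// ge_min lexx orbT.
  exists (m / 2); first by rewrite divr_gt0.
  split.
    by apply/ltW/He; rewrite addrAC subrr add0r gtr0_norm; lra.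
  have : 0 < m * k1 by rewrite mulr_gt0.
  lra.
have [T0 T00 HT0] := solution_small (Gpos (ltW (mulr_gt0 (ltr0Sn R 1) M_gt0))).
have [T1 T10 HT1] := delay_ge T0.
have [T2 T20 HT2] : exists2 T, 0 < T & forall t, T <= t -> r' < (t - tau t) / t.
  suff /near_pinftyP : \forall t \near +oo, r' < (t - tau t) / t by [].
  exact: cvgr_gt delay_ratio _ r'r.
have [T [TT1 TT2 TT0 _]] := ubound4 T1 T2 T0 T0.
have T_gt0 := lt_le_trans T00 TT0.
(* With this D the increment k1 / psi of w is at most M up to time T. *)
pose D := k1 * T `^ (1 + nu) / M.
have D0 : 0 < D by rewrite divr_gt0// mulr_gt0// powR_gt0.
pose psi (t : R) : R := t `^ (- 1) + D * t `^ (- (1 + nu)).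
have psi0 t : 0 < t -> 0 < psi t.
  by move=> t0; apply: addr_gt0; [|apply: mulr_gt0 => //]; exact: powR_gt0.
have powRN_anti (p s t : R) : 0 <= p -> 0 < s -> s <= t -> t `^ (- p) <= s `^ (- p).
  move=> p0 s0 st; have t0 := lt_le_trans s0 st.
  rewrite !powRN lef_pV2 ?posrE ?powR_gt0//.
  by apply: ge0_ler_powR; rewrite ?nnegrE// ltW.
have nu10 : 0 <= 1 + nu by lra.
have psi_anti s t : 0 < s -> s <= t -> psi t <= psi s.
  by move=> s0 st; rewrite lerD ?ler_pM2l// powRN_anti.
pose w (t : R) : R := M + k1 * (psi t)^-1.
have w_ge t : 0 < t -> M <= w t.
  by move=> t0; rewrite lerDl mulr_ge0 ?(ltW k10)// invr_ge0 ltW// psi0.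
have w_gt0 t : 0 < t -> 0 < w t.
  by move=> t0; rewrite (lt_le_trans M_gt0)// w_ge.
have w_mono s t : 0 < s -> s <= t -> w s <= w t.
  move=> s0 st; have t0 := lt_le_trans s0 st.
  by rewrite lerD2l ler_pM2l// lef_pV2 ?posrE ?psi0// psi_anti.
have w_T s : 0 < s -> s <= T -> w s <= 2 * M.
  move=> s0 sT; apply: (le_trans (w_mono _ _ s0 sT)).
  suff : k1 * (psi T)^-1 <= M by rewrite /w; lra.
  rewrite ler_pdivrMr ?psi0//; apply: (@le_trans _ _ (M * (D * T `^ (- (1 + nu))))).
    rewrite (_ : M * _ = k1)// /D powRN; field.
    by rewrite !gt_eqF ?powR_gt0.
  by rewrite ler_pM2l// lerDr powR_ge0.
pose w' (t : R) : R := k1 * (- (psi t) ^- 2 * ((- 1) * t `^ (- 1 - 1) +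
   D * ((- (1 + nu)) * t `^ (- (1 + nu) - 1)))).
have w_deriv (t : R) : 0 < t -> is_derive t 1 w (w' t).
  move=> t0; have h1 := is_derive1_powR (- 1) t0.
  have h2 := is_deriveCM D (is_derive1_powR (- (1 + nu)) t0).
  have h3 := is_deriveV (lt0r_neq0 (psi0 t t0)) (is_deriveD h1 h2).
  by have := is_deriveD (is_derive_cst M t 1) (is_deriveCM k1 h3); rewrite add0r.
have u_deriv (t : R) : 0 < t -> is_derive t 1 (fun t => Gam (w t)) (- g (Gam (w t)) * w' t).
  move=> t0; apply: (is_derive1_comp (f := Gam) (g := w)); last exact: w_deriv.
  exact: (is_derive_Gam g_gt0 g_cont g_ndecr beta_gt1 g_RV (w_gt0 t t0)).
have w'_le t : 0 < t -> w' t <= k2.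
  move=> t0; apply: (le_trans _ Hnuk); rewrite /w' ler_pM2l//.
  have P := psi0 t t0; have nt0 : t != 0 by rewrite gt_eqF.
  have A0 : 0 < t `^ (- 1) by exact: powR_gt0.
  have B0 : 0 < t `^ (- (1 + nu)) by exact: powR_gt0.
  have E (Q X Y : R) : - Q ^- 2 * (- 1 * X + D * (- (1 + nu) * Y)) =
    (X + D * ((1 + nu) * Y)) / Q ^+ 2 by ring.
  rewrite E ler_pdivrMr ?exprn_gt0//.
  rewrite ![t `^ (_ - 1)]powRD ?nt0 ?implybT// /psi expr2.
  move: (t `^ (- 1)) (t `^ (- (1 + nu))) A0 B0 => A Y A0 Y0.
  have B0 : 0 < D * Y by rewrite mulr_gt0.
  have -> : D * ((1 + nu) * (Y * A)) = (1 + nu) * (D * Y * A) by ring.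
  move: (D * Y) B0 => B B0; rewrite -subr_ge0.
  rewrite (_ : _ - _ = nu * (A * A) + (1 + nu) * (A * B + B * B)); last by ring.
  by rewrite addr_ge0 ?mulr_ge0 ?addr_ge0 ?mulr_ge0 ?ltW.
have key : forall t, T0 <= t -> x t < Gam (w t).
  apply: (@compare_above _ a b g tau x d b_gt0 gmon (fun t => Gam (w t)) T0 T) => //.
  - by move=> t Tt; apply: x_gt0; rewrite (le_trans _ Tt)// ltW.
  - by move=> t Tt; apply: x_deriv; exact: lt_le_trans Tt.
  - by move=> t Tt; apply: HT1; rewrite (le_trans TT1)// ltW.
  - by move=> t Tt; apply: is_derive_continuous (u_deriv _ _); exact: lt_le_trans Tt.
  - move=> s t T0s st; have s0 := lt_le_trans T00 T0s; have t0 := lt_le_trans s0 st.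
    by rewrite Gle ?(ltW (w_gt0 _ _))// w_mono.
  - move=> s /andP[T0s sT]; have s0 := lt_le_trans T00 T0s.
    rewrite (lt_le_trans (HT0 _ T0s))// Gle ?(ltW (w_gt0 _ _)) ?w_T//.
    by rewrite mulr_ge0// ltW.
  move=> t Tt; have t0 : 0 < t by rewrite (lt_trans _ Tt).
  have /andP[T0p pt] : T0 <= t - tau t <= t by apply: HT1; rewrite (le_trans TT1)// ltW.
  set p := t - tau t in T0p pt *.
  have p0 : 0 < p by rewrite (lt_le_trans T00).
  have wt0 := w_gt0 t t0; have wp0 := w_gt0 p p0.
  have pr : r' * t <= p.
    by rewrite -ler_pdivlMr// ltW// HT2// (le_trans TT2)// ltW.
  have r't0 : 0 < r' * t by rewrite mulr_gt0.
  have wpt : rho * w t <= w p.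
    apply: le_trans (w_mono _ _ r't0 pr).
    rewrite /w mulrDr; apply: lerD.
      by rewrite ler_piMl ?(ltW M_gt0)//; lra.
    rewrite mulrCA ler_pM2l// ler_pdivrMr ?psi0// [leRHS]mulrC ler_pdivlMr ?psi0//.
    have pM e : (r' * t) `^ e = r' `^ e * t `^ e by rewrite powRM// ltW.
    rewrite /psi !pM mulrDr; apply: lerD.
      rewrite mulrA ler_piMl ?powR_ge0// powRN ler_pdivrMr ?powR_gt0// mul1r.
      by rewrite powRr1 ltW.
    rewrite mulrCA ler_pM2l// mulrA ler_piMl ?powR_ge0//.
    by rewrite powRN ler_pdivrMr ?powR_gt0// mul1r.
  have rw0 : 0 < rho * w t by rewrite mulr_gt0.
  have gp : Gam (w p) <= Gam (rho * w t) by rewrite Gle ?(ltW wp0) ?(ltW rw0).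
  have rwd : Gam (rho * w t) <= d by apply: HMd; exact: w_ge.
  split; first exact: le_trans rwd.
  eexists; first exact: u_deriv.
  have gle : g (Gam (w p)) <= g (Gam (rho * w t)) by apply: gmon => //; exact: Gpos (ltW wp0).
  have gu0 : 0 < g (Gam (w t)) by apply: g_gt0; exact: Gpos (ltW wt0).
  have : M0 <= w t by rewrite (le_trans MM0)// w_ge.
  move=> /HM0; rewrite ltr_pdivrMr// -(ltr_pM2l b_gt0) mulrA [b * (_ / b)]mulrC divfK ?gt_eqF// => h.
  have h1 : b * g (Gam (w p)) <= b * g (Gam (rho * w t)) by rewrite ler_pM2l.
  have h2 : g (Gam (w t)) * w' t <= g (Gam (w t)) * k2 by rewrite ler_pM2l// w'_le.
  lra.
pose C := D * k / (k1 - k).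
have kk : 0 < k1 - k by rewrite subr_gt0.
have C0 : 0 < C by apply: divr_gt0 => //; exact: mulr_gt0.
exists (Num.max T0 (C `^ nu^-1)) => [|t]; first by rewrite lt_max T00.
rewrite ge_max => /andP[Tt Ct]; have t0 := lt_le_trans T00 Tt.
apply/(le_trans (ltW (key t Tt))).
rewrite Gle ?(ltW (w_gt0 t t0)) ?mulr_ge0 ?(ltW k0) ?(ltW t0)//.
apply: (@le_trans _ _ (k1 * (psi t)^-1)); last by rewrite lerDr ltW.
rewrite ler_pdivlMr ?psi0//.
have Cnu : C <= t `^ nu.
  rewrite -[C]powRr1 ?(ltW C0)// -(mulVf (lt0r_neq0 nu0)) powRrM.
  by apply: ge0_ler_powR; rewrite ?nnegrE ?powR_ge0 ?(ltW nu0) ?(ltW t0).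
have E : t * psi t = 1 + D / t `^ nu.
  rewrite /psi !powRN powRD ?(gt_eqF t0) ?implybT// powRr1 ?(ltW t0)//.
  by field; rewrite !gt_eqF ?powR_gt0.
rewrite -mulrA E mulrDr mulr1 -lerBrDl mulrA ler_pdivrMr ?powR_gt0//.
by rewrite mulrC [leRHS]mulrC -ler_pdivrMr ?subr_gt0// [k * D]mulrC.
Qed.

Lemma slow_delay_limit :
  x t / Gam t @[t --> +oo] --> Ks `^ (- (beta - 1)^-1).
Proof.
set e := (beta - 1)^-1; have e0 : 0 < e by rewrite invr_gt0 subr_gt0.
have L0 : 0 < Ks `^ (- e) by exact: powR_gt0.
have root A : 0 < A -> exists2 k : R, 0 < k & k `^ (- e) = A.
  move=> A0; exists (A `^ (- (beta - 1))); first exact: powR_gt0.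
  by rewrite -powRrM mulrNN mulfV ?powRr1 ?(ltW A0)// gt_eqF// subr_gt0.
have anti k k' : 0 < k -> 0 < k' -> k `^ (- e) < k' `^ (- e) -> k' < k.
  move=> k0 k'0; rewrite !powRN ltf_pV2 ?posrE ?powR_gt0//.
  apply: contraTT; rewrite -!leNgt => h.
  by apply: ge0_ler_powR; rewrite ?nnegrE// ltW.
have Gam_pos : \forall t \near +oo, 0 < Gam t.
  by apply/near_pinftyP; exists 1 => // t t1; apply: Gpos; rewrite (le_trans _ t1).
apply: cvg_pos_bounds => // A.
- move=> LA; pose A' := (Ks `^ (- e) + A) / 2.
  have A'A : A' < A by rewrite /A'; lra.
  have LA' : Ks `^ (- e) < A' by rewrite /A'; lra.
  have [k k0 kA'] := root A' (lt_trans L0 LA').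
  have kKs : k < Ks by apply: anti => //; rewrite kA'.
  have [T T0 HT] := solution_le_Gam k0 kKs.
  have N1 : \forall t \near +oo, Gam (k * t) / Gam t < A.
    have := Gam_RV g_gt0 g_cont g_ndecr beta_gt1 g_RV k0; rewrite -/e kA' => h.
    exact: cvgr_lt h _ A'A.
  have N2 : \forall t \near +oo, x t <= Gam (k * t) by apply/near_pinftyP; exists T.
  near=> t; have t0 : 0 < Gam t by near: t.
  have h1 : Gam (k * t) / Gam t < A by near: t.
  have h2 : x t <= Gam (k * t) by near: t.
  by apply/ltW/(le_lt_trans _ h1); rewrite ler_pM2r// invr_gt0.
- move=> /andP[A0 AL]; pose A' := (Ks `^ (- e) + A) / 2.
  have AA' : A < A' by rewrite /A'; lra.
  have A'L : A' < Ks `^ (- e) by rewrite /A'; lra.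
  have [k k0 kA'] := root A' (lt_trans A0 AA').
  have kKs : Ks < k by apply: anti => //; rewrite kA'.
  have [T T0 HT] := solution_ge_Gam kKs.
  have N1 : \forall t \near +oo, A < Gam (k * t) / Gam t.
    have := Gam_RV g_gt0 g_cont g_ndecr beta_gt1 g_RV k0; rewrite -/e kA' => h.
    exact: cvgr_gt h _ AA'.
  have N2 : \forall t \near +oo, Gam (k * t) <= x t by apply/near_pinftyP; exists T.
  near=> t; have t0 : 0 < Gam t by near: t.
  have h1 : A < Gam (k * t) / Gam t by near: t.
  have h2 : Gam (k * t) <= x t by near: t.
  by apply/ltW/(lt_le_trans h1); rewrite ler_pM2r// invr_gt0.
Unshelve. all: by end_near. Qed.

End SlowDelay.

(** ** Delay of unit length for the clock S *)

Section FastDelay.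
Variables sigma S : R -> R.
Hypothesis ab : b < a.
Hypothesis S_ge0 : forall t, 0 <= S t.
Hypothesis S_infty : S t @[t --> +oo] --> +oo.
Hypothesis S_deriv : exists2 T : R, 0 < T & forall t, T <= t ->
  0 < sigma t /\ is_derive t 1 S (sigma t)^-1.
Hypothesis S_delay : S t - S (t - tau t) @[t --> +oo] --> (1 : R).
(** The rate for which exp(-mu S) gains the factor (a/b)^(1/beta) over one
    delay. *)
Let mu := ln (a / b) / beta.

Let ab1 : 1 < a / b. Proof. by rewrite ltr_pdivlMr// mul1r. Qed.
Let beta0 : 0 < beta. Proof. by rewrite (lt_trans ltr01). Qed.

Lemma rate_gt0 : 0 < mu.
Proof. by rewrite divr_gt0// ln_gt0. Qed.

Let expR_powR (m : R) : expR m `^ beta = expR (m * beta).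
Proof. by rewrite /powR gt_eqF ?expR_gt0// expRK mulrC. Qed.

Let expR_mu : expR (mu * beta) = a / b.
Proof. by rewrite divfK ?gt_eqF// lnK// posrE (lt_trans ltr01). Qed.

Lemma clock_ndecr : exists2 T : R, 0 < T & forall s t, T <= s -> s <= t -> S s <= S t.
Proof.
have [T T0 H] := S_deriv; exists T => // s t Ts st.
apply: (@is_derive_ndecr _ S (fun u => (sigma u)^-1)) => // u /andP[su _];
  have [sig Su] := H u (le_trans Ts su) => //.
by rewrite invr_ge0 ltW.
Qed.

(** For m > mu the delayed term dominates, so that the right-hand side at
    u = c exp(-m S) is positive, while u decreases; c is small enough for u < x
    initially. *)
Lemma solution_ge_exp (m : R) : mu < m -> exists2 c, 0 < c &
  \forall t \near +oo, c * expR (- m * S t) <= x t.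
Proof.
move=> mum; pose m' := (mu + m) / 2.
have mu0 := rate_gt0.
have mum' : mu < m' by rewrite /m'; lra.
have m'm : m' < m by rewrite /m'; lra.
have m0 : 0 < m by lra.
pose kappa := expR m'; have kappa0 : 0 < kappa by exact: expR_gt0.
have kab : a / b < kappa `^ beta by rewrite expR_powR -expR_mu ltr_expR ltr_pM2r.
have [d1 d10 Hd1] : exists2 d, 0 < d & forall y, 0 < y <= d -> a / b < g (kappa * y) / g y.
  suff /near_at_right0P : \forall y \near 0^'+, a / b < g (kappa * y) / g y by [].
  exact: cvgr_gt (g_RV kappa0) _ kab.
have [d d0 gmon] := g_ndecr.
have [Ts Ts0 HTs] := S_deriv.
have [T1 T10 HT1] := solution_small d0.
have [T0 [TsT0 T1T0 _ _]] := ubound4 Ts T1 Ts T1.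
have T0_gt0 := lt_le_trans Ts0 TsT0.
have [T2 T20 HT2] := delay_ge T0.
have [T3 T30 HT3] : exists2 T, 0 < T & forall t, T <= t -> m' / m < S t - S (t - tau t).
  suff /near_pinftyP : \forall t \near +oo, m' / m < S t - S (t - tau t) by [].
  by apply: cvgr_gt S_delay _ _; rewrite ltr_pdivrMr// mul1r.
have [T [TT0 TT2 TT3 _]] := ubound4 T0 T2 T3 T3.
have [xm xm0 Hxm] := solution_min T0_gt0 TT0.
pose c := Num.min xm (Num.min d1 d) / 2.
have mn0 : 0 < Num.min xm (Num.min d1 d) by rewrite !lt_min xm0 d10.
have c0 : 0 < c by rewrite divr_gt0.
have [cxm cd1 cd] : [/\ c < xm, c <= d1 & c <= d].
  have : c < Num.min xm (Num.min d1 d) by rewrite ltr_pdivrMr// mulr_natr mulr2n ltrDl.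
  by rewrite !lt_min => /and3P[-> /ltW -> /ltW ->].
exists c => //; apply/near_pinftyP; exists T0 => // t Tt.
pose u (t : R) : R := c * expR (- m * S t).
have u0 s : 0 < u s by rewrite mulr_gt0// expR_gt0.
have uc s : u s <= c.
  by rewrite ler_piMr ?(ltW c0)// -expR0 ler_expR mulNr oppr_le0 mulr_ge0// ltW.
have u_deriv (s : R) : T0 <= s -> is_derive s 1 u (c * (expR (- m * S s) * (- m * (sigma s)^-1))).
  move=> T0s; have [_ hS] := HTs s (le_trans TsT0 T0s).
  have h := is_derive1_comp (is_derive_expR _) (is_deriveCM (- m) hS).
  exact: (is_deriveCM c h).
apply: ltW; move: t Tt.
apply: (@compare_below _ a b g tau x d b_gt0 gmon u T0 T) => //.
- by move=> t Tt; apply: x_gt0; rewrite (le_trans _ Tt)// ltW.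
- by move=> t Tt; apply: x_deriv; exact: lt_le_trans Tt.
- by move=> t Tt; apply: HT2; rewrite (le_trans TT2)// ltW.
- by move=> t Tt; apply: is_derive_continuous (u_deriv _ Tt).
- by move=> t Tt; apply/ltW/HT1; exact: le_trans Tt.
- by move=> s sI; rewrite (le_lt_trans (uc s))// (lt_le_trans cxm)// Hxm.
move=> t Tt; have T0t : T0 <= t by rewrite (le_trans TT0)// ltW.
eexists; first exact: u_deriv.
have [sig _] := HTs t (le_trans TsT0 T0t).
apply: (@le_lt_trans _ _ 0).
  rewrite (_ : c * _ = - (u t * (m * (sigma t)^-1))); last by rewrite /u; ring.
  by rewrite oppr_le0 mulr_ge0 ?(ltW (u0 t))// mulr_ge0 ?invr_ge0 ?ltW.
rewrite mulNr addrC subr_gt0.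
have kup : kappa * u t <= u (t - tau t).
  rewrite /kappa /u mulrCA ler_pM2l// -expRD ler_expR.
  have := HT3 t (le_trans TT3 (ltW Tt)); rewrite ltr_pdivrMr//; lra.
have : a / b < g (kappa * u t) / g (u t) by apply: Hd1; rewrite u0 (le_trans (uc t)).
rewrite ltr_pdivlMr ?g_gt0// => gku.
have -> : a * g (u t) = b * (a / b * g (u t)) by field; rewrite gt_eqF.
rewrite ltr_pM2l//; apply: (lt_le_trans gku); apply: gmon => //.
- by rewrite mulr_gt0.
- exact: le_trans (uc _) cd.
Qed.

(** Equivalently sigma u^(beta-1) tends to +oo for u = exp(-mu S): the slope
    u' = - mu u / sigma is then negligible with respect to u^beta. *)
Hypothesis clock_slow : sigma t * expR (- (mu * (beta - 1)) * S t) @[t --> +oo] --> +oo.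

(** For m < mu the right-hand side at u = C exp(-m S) is at most
    - (a - b A) g(u) with A < a/b.  The power bound on g has exponent 1 + e,
    where e m = mu (beta - 1), so that the growth hypothesis makes g(u)
    dominate the slope m u / sigma.  That step starts at a time depending only
    on delta, before T, hence C, is chosen. *)
Lemma solution_le_exp (m : R) : 0 < m -> m < mu -> exists2 C, 0 < C &
  \forall t \near +oo, x t <= C * expR (- m * S t).
Proof.
move=> m0 mmu; pose m' := (mu + m) / 2.
have mu0 := rate_gt0.
have mm' : m < m' by rewrite /m'; lra.
have m'mu : m' < mu by rewrite /m'; lra.
pose kappa := expR m'; have kappa0 : 0 < kappa by exact: expR_gt0.
have kab : kappa `^ beta < a / b by rewrite expR_powR -expR_mu ltr_expR ltr_pM2r.
pose A := (kappa `^ beta + a / b) / 2.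
have kA : kappa `^ beta < A by rewrite /A; lra.
have Aab : A < a / b by rewrite /A; lra.
have c10 : 0 < a - b * A by rewrite subr_gt0 mulrC -ltr_pdivlMr.
have [d1 d10 Hd1] : exists2 d, 0 < d & forall y, 0 < y <= d -> g (kappa * y) / g y < A.
  suff /near_at_right0P : \forall y \near 0^'+, g (kappa * y) / g y < A by [].
  exact: cvgr_lt (g_RV kappa0) _ kA.
pose e := mu * (beta - 1) / m.
have em : e * m = mu * (beta - 1) by rewrite divfK ?gt_eqF.
have eb : beta < 1 + e.
  rewrite -ltrBlDl ltr_pdivlMr// mulrC ltr_pM2r// subr_gt0//.
have [d2 d20 [c2 c20 Hc2]] := g_ge_powR g_gt0 g_ndecr beta_gt1 g_RV eb.
have [d d0 gmon] := g_ndecr.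
pose delta := Num.min d1 (Num.min d2 (d / kappa)).
have delta0 : 0 < delta by rewrite !lt_min d10 d20 divr_gt0.
have [dd1 dd2 ddk] : [/\ delta <= d1, delta <= d2 & kappa * delta <= d].
  by rewrite [kappa * _]mulrC -ler_pdivlMr//; split; rewrite !ge_min lexx ?orbT.
have [Ts Ts0 HTs] := S_deriv.
have [Tm Tm0 HTm] := clock_ndecr.
have [T1 T10 HT1] := solution_small delta0.
have [T0 [TsT0 T1T0 TmT0 _]] := ubound4 Ts T1 Tm T1.
have T0_gt0 := lt_le_trans Ts0 TsT0.
have [T2 T20 HT2] := delay_ge T0.
have [T3 T30 HT3] : exists2 T, 0 < T & forall t, T <= t -> S t - S (t - tau t) < m' / m.
  suff /near_pinftyP : \forall t \near +oo, S t - S (t - tau t) < m' / m by [].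
  by apply: cvgr_lt S_delay _ _; rewrite ltr_pdivlMr// mul1r.
(* Above N the slope m u / sigma is less than (a - b A) c2 u^(1+e). *)
pose N := m / ((a - b * A) * c2 * delta `^ e).
have [T4 T40 HT4] : exists2 T, 0 < T & forall t, T <= t -> N < sigma t * expR (- (mu * (beta - 1)) * S t).
  suff /near_pinftyP : \forall t \near +oo, N < sigma t * expR (- (mu * (beta - 1)) * S t) by [].
  by move/cvgryPgt : clock_slow => /(_ N).
have [T [TT0 TT2 TT3 TT4]] := ubound4 T0 T2 T3 T4.
pose C := delta * expR (m * S T).
have C0 : 0 < C by rewrite mulr_gt0// expR_gt0.
exists C => //; apply/near_pinftyP; exists T0 => // t Tt.
pose u (t : R) : R := C * expR (- m * S t).
have uE s : u s = delta * expR (m * (S T - S s)).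
  by rewrite /u /C -mulrA -expRD mulNr mulrBr.
have u0 s : 0 < u s by rewrite mulr_gt0// expR_gt0.
have u_anti s s' : T0 <= s -> s <= s' -> u s' <= u s.
  move=> T0s ss'; rewrite ler_pM2l// ler_expR !mulNr lerN2 ler_pM2l//.
  by apply: HTm => //; exact: le_trans T0s.
have u_early s : T0 <= s -> s <= T -> delta <= u s.
  move=> T0s sT; rewrite uE ler_peMr ?(ltW delta0)// -expR0 ler_expR mulr_ge0 ?(ltW m0)//.
  by rewrite subr_ge0 HTm// (le_trans TmT0).
have u_late s : T <= s -> u s <= delta.
  move=> Ts'; rewrite uE ler_piMr ?(ltW delta0)// -expR0 ler_expR mulr_ge0_le0 ?(ltW m0)//.
  by rewrite subr_le0 HTm// (le_trans TmT0).
have u_deriv (s : R) : T0 <= s -> is_derive s 1 u (C * (expR (- m * S s) * (- m * (sigma s)^-1))).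
  move=> T0s; have [_ hS] := HTs s (le_trans TsT0 T0s).
  have h := is_derive1_comp (is_derive_expR _) (is_deriveCM (- m) hS).
  exact: (is_deriveCM C h).
apply: ltW; move: t Tt.
apply: (@compare_above _ a b g tau x d b_gt0 gmon u T0 T) => //.
- by move=> t Tt; apply: x_gt0; rewrite (le_trans _ Tt)// ltW.
- by move=> t Tt; apply: x_deriv; exact: lt_le_trans Tt.
- by move=> t Tt; apply: HT2; rewrite (le_trans TT2)// ltW.
- by move=> t Tt; apply: is_derive_continuous (u_deriv _ Tt).
- move=> s /andP[T0s sT]; apply: lt_le_trans (u_early _ T0s sT).
  by apply: HT1; exact: le_trans T0s.
move=> t Tt; have T0t : T0 <= t by rewrite (le_trans TT0)// ltW.
have /andP[T0p pt] : T0 <= t - tau t <= t by apply: HT2; rewrite (le_trans TT2)// ltW.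
set p := t - tau t in T0p pt *.
have utd := u_late t (ltW Tt).
have upk : u p <= kappa * u t.
  rewrite /kappa /u mulrCA ler_pM2l// -expRD ler_expR.
  have := HT3 t (le_trans TT3 (ltW Tt)); rewrite ltr_pdivlMr// -/p; lra.
have kud : kappa * u t <= d by rewrite (le_trans _ ddk)// ler_pM2l.
split; first exact: le_trans kud.
eexists; first exact: u_deriv.
have [sig _] := HTs t (le_trans TsT0 T0t).
have gup : g (u p) <= A * g (u t).
  apply: (@le_trans _ _ (g (kappa * u t))); first exact: gmon.
  rewrite -ler_pdivrMr ?g_gt0//; apply/ltW/Hd1.
  by rewrite u0 (le_trans utd).
have gut : c2 * u t `^ (1 + e) <= g (u t) by apply: Hc2; rewrite u0 (le_trans utd).
have ute : delta `^ e * expR (- (mu * (beta - 1)) * S t) <= u t `^ e.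
  rewrite uE powRM ?(ltW delta0) ?expR_ge0// ler_pM2l ?powR_gt0//.
  rewrite /powR gt_eqF ?expR_gt0// expRK ler_expR -em.
  have : 0 <= e * m * S T.
    by apply: mulr_ge0 => //; rewrite em mulr_ge0 ?(ltW mu0)// subr_ge0 ltW.
  lra.
have big : m < (a - b * A) * c2 * u t `^ e * sigma t.
  have := HT4 t (le_trans TT4 (ltW Tt)); rewrite /N ltr_pdivrMr ?mulr_gt0 ?powR_gt0//.
  move=> /lt_le_trans; apply.
  rewrite (_ : sigma t * _ * _ = (a - b * A) * c2 * (delta `^ e * expR (- (mu * (beta - 1)) * S t)) * sigma t); last by ring.
  by rewrite ler_pM2r// ler_pM2l// mulr_gt0.
have h1 : b * g (u p) <= b * (A * g (u t)) by rewrite ler_pM2l.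
have h2 : (a - b * A) * (c2 * u t `^ (1 + e)) <= (a - b * A) * g (u t) by rewrite ler_pM2l.
have h3 : m * (sigma t)^-1 * u t < (a - b * A) * (c2 * u t `^ (1 + e)).
  rewrite powRD ?(gt_eqF (u0 t)) ?implybT// powRr1 ?(ltW (u0 t))//.
  rewrite (_ : _ * (c2 * _) = (a - b * A) * c2 * u t `^ e * u t); last by ring.
  by rewrite ltr_pM2r// ltr_pdivrMr.
have -> : C * (expR (- m * S t) * (- m * (sigma t)^-1)) = - (m * (sigma t)^-1 * u t).
  by rewrite /u; ring.
lra.
Qed.

Lemma fast_delay_limit : ln (x t) / S t @[t --> +oo] --> - mu.
Proof.
have mu0 := rate_gt0.
apply: (cvg_ratio_infty S_infty) => e e0.
pose m1 := mu + e; pose m2 := Num.max (mu / 2) (mu - e).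
have m20 : 0 < m2 by rewrite lt_max divr_gt0.
have m2mu : m2 < mu by rewrite gt_max; apply/andP; split; lra.
have m2e : mu - e <= m2 by rewrite le_max lexx orbT.
have [c c0 Hc] := solution_ge_exp (m := m1) (ltac:(rewrite /m1; lra)).
have [C C0 HC] := solution_le_exp m20 m2mu.
exists (`|ln c| + `|ln C|).
have xp : \forall t \near +oo, 0 < x t.
  by apply/near_pinftyP; exists 1 => // t t1; apply: x_gt0; rewrite (le_trans _ t1).
near=> t.
have xt : 0 < x t by near: t.
have h1 : c * expR (- m1 * S t) <= x t by near: t.
have h2 : x t <= C * expR (- m2 * S t) by near: t.
have St := S_ge0 t.
have l1 : ln c - m1 * S t <= ln (x t).
  rewrite -[X in ln c - X]opprK opprK -mulNr -[X in ln c + X]expRK -lnM ?posrE ?expR_gt0//.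
  by rewrite ler_ln ?posrE// mulr_gt0// expR_gt0.
have l2 : ln (x t) <= ln C - m2 * S t.
  rewrite -mulNr -[X in ln C + X]expRK -lnM ?posrE ?expR_gt0//.
  by rewrite ler_ln ?posrE// mulr_gt0// expR_gt0.
have l3 : (mu - e) * S t <= m2 * S t by rewrite ler_wpM2r.
have n1 := ler_norm (ln C); have n2 := ler_norm (- ln c); rewrite normrN in n2.
have n3 := normr_ge0 (ln C); have n4 := normr_ge0 (ln c).
by rewrite /m1 in l1; rewrite ler_norml; apply/andP; split; lra.
Unshelve. all: by end_near. Qed.

End FastDelay.
End Solution.

(** * The clock compared with the logarithm; lower and upper limits *)

Section ClockVersusLog.
Context {R : realType} (sigma S p : R -> R).
Hypothesis S_infty : S t @[t --> +oo] --> +oo.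
Hypothesis S_deriv : exists2 T : R, 0 < T & forall t, T <= t ->
  0 < sigma t /\ is_derive t 1 S (sigma t)^-1.

(** ln t - l S has derivative (sigma/t - l) / sigma, small relative to
    S' = 1 / sigma. *)
Lemma log_clock_increment (l e : R) :
  (\forall t \near +oo, `|sigma t / t - l| <= e) ->
  exists2 T, 0 < T & forall s t, T <= s -> s <= t ->
    `|(ln t - ln s) - l * (S t - S s)| <= e * (S t - S s).
Proof.
move=> /near_pinftyP[T1 T10 HT1]; have [T2 T20 HT2] := S_deriv.
have [T [TT1 TT2 _ _]] := ubound4 T1 T2 T1 T1.
exists T => [|s t Ts st]; first exact: lt_le_trans TT1.
suff key c : `|c| <= 1 ->
    c * ((ln t - ln s) - l * (S t - S s)) <= e * (S t - S s).
  rewrite ler_norml; apply/andP; split.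
    by have := key (-1); rewrite normrN normr1 lexx => /(_ isT); lra.
  by have := key 1; rewrite normr1 lexx => /(_ isT); lra.
move=> c1.
have : e * S s - c * (ln s - l * S s) <= e * S t - c * (ln t - l * S t).
  apply: (@is_derive_ndecr _ (fun u => e * S u - c * (ln u - l * S u))
    (fun u => e * (sigma u)^-1 - c * (u^-1 - l * (sigma u)^-1))) => // u /andP[su _];
    have Tu := le_trans Ts su; have u0 := lt_le_trans T10 (le_trans TT1 Tu);
    have [sig hS] := HT2 u (le_trans TT2 Tu).
  - exact: (is_deriveB (is_deriveCM e hS) (is_deriveCM c (is_deriveB (is_derive1_ln u0) (is_deriveCM l hS)))).
  - have -> : e * (sigma u)^-1 - c * (u^-1 - l * (sigma u)^-1) =
      (sigma u)^-1 * (e - c * (sigma u / u - l)) by field; rewrite !gt_eqF.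
    rewrite mulr_ge0 ?invr_ge0 ?(ltW sig)// subr_ge0 (le_trans (ler_norm _))// normrM.
    apply: le_trans (HT1 u (le_trans TT1 Tu)).
    by rewrite ler_piMl.
lra.
Qed.

Lemma log_clock_ratio (l : R) : sigma t / t @[t --> +oo] --> l ->
  ln t / S t @[t --> +oo] --> l.
Proof.
move=> sl; apply: (cvg_ratio_infty S_infty) => e e0.
have N : \forall t \near +oo, `|sigma t / t - l| <= e.
  by have /cvgrPdist_le/(_ e e0) := sl; apply: filterS => t; rewrite distrC.
have [T T0 HT] := log_clock_increment N.
exists (`|ln T - l * S T| - e * S T); apply/near_pinftyP; exists T => // t Tt.
have := HT T t (lexx T) Tt.
have := ler_normD (ln T - l * S T) ((ln t - ln T) - l * (S t - S T)).
rewrite (_ : (ln T - l * S T) + _ = ln t - l * S t); last by ring.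
lra.
Qed.

Lemma delay_ratio_cvg (l : R) : sigma t / t @[t --> +oo] --> l ->
  p t @[t --> +oo] --> +oo -> (\forall t \near +oo, p t <= t) ->
  S t - S (p t) @[t --> +oo] --> (1 : R) ->
  p t / t @[t --> +oo] --> expR (- l).
Proof.
move=> sl p_infty pt Sp.
have lnp : ln t - ln (p t) @[t --> +oo] --> l.
  have : (ln t - ln (p t)) / (S t - S (p t)) @[t --> +oo] --> l.
    apply/cvg_ratioP => [|e e0].
      exact: cvgr_gt Sp _ ltr01.
    have N : \forall t \near +oo, `|sigma t / t - l| <= e.
      by have /cvgrPdist_le/(_ e e0) := sl; apply: filterS => t; rewrite distrC.
    have [T T0 HT] := log_clock_increment N.
    have pT : \forall t \near +oo, T <= p t by move/cvgryPge : p_infty => /(_ T).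
    by near=> t; apply: HT; [near: t; exact: pT|near: t; exact: pt].
  move=> /cvgM/(_ Sp); rewrite mulr1; apply: cvg_trans; apply: near_eq_cvg.
  have N : \forall t \near +oo, 0 < S t - S (p t) by exact: cvgr_gt Sp _ ltr01.
  near=> t; have h : 0 < S t - S (p t) by near: t.
  by rewrite /= divfK// gt_eqF.
have /(cvg_comp _ _ (cvgN lnp)) := @continuous_expR R (- l).
apply: cvg_trans; apply: near_eq_cvg.
have pT : \forall t \near +oo, 1 <= p t by move/cvgryPge : p_infty => /(_ 1).
near=> t; have pt1 : 1 <= p t by near: t.
have p0 : 0 < p t by rewrite (lt_le_trans ltr01).
have t0 : 0 < t by rewrite (lt_le_trans p0)//; near: t; exact: pt.
by rewrite /= opprB expRB !lnK.
Unshelve. all: by end_near. Qed.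

(** sigma >= l t integrates to l S <= ln t + C, so the product is at least a
    constant times t^(1 - q/l). *)
Lemma clock_slow_of_linear (l q : R) : 0 <= q -> q < l ->
  (\forall t \near +oo, l * t <= sigma t) ->
  sigma t * expR (- q * S t) @[t --> +oo] --> +oo.
Proof.
move=> q0 ql /near_pinftyP[T1 T10 HT1]; have [T2 T20 HT2] := S_deriv.
have l0 : 0 < l by rewrite (le_lt_trans q0).
have [T [TT1 TT2 _ _]] := ubound4 T1 T2 T1 T1.
have T0 := lt_le_trans T10 TT1.
pose C := l * S T - ln T.
have Sln t : T <= t -> l * S t <= ln t + C.
  move=> Tt; suff : ln T - l * S T <= ln t - l * S t by rewrite /C; lra.
  apply: (@is_derive_ndecr _ (fun u => ln u - l * S u) (fun u => u^-1 - l * (sigma u)^-1))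
    => // u /andP[Tu _]; have u0 := lt_le_trans T0 Tu;
    have [sig hS] := HT2 u (le_trans TT2 Tu).
  - exact: (is_deriveB (is_derive1_ln u0) (is_deriveCM l hS)).
  - rewrite subr_ge0 ler_pdivrMr// mulrC ler_pdivlMr//.
    exact: HT1 (le_trans TT1 Tu).
pose k := q / l.
have k1 : 0 < 1 - k by rewrite subr_gt0 ltr_pdivrMr// mul1r.
have k0 : 0 <= k by rewrite divr_ge0// ltW.
apply/cvgryPge => A; apply/near_pinftyP.
pose K := (A / l - 1 + k * C) / (1 - k).
exists (Num.max T (expR K)) => [|t]; first by rewrite lt_max T0.
rewrite ge_max => /andP[Tt Kt]; have t0 := lt_le_trans T0 Tt.
have lnK' : K <= ln t by rewrite -[K]expRK ler_ln ?posrE ?expR_gt0.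
have h1 : A / l - 1 + k * C <= (1 - k) * ln t by rewrite [leRHS]mulrC -ler_pdivrMr.
have qk : q = k * l by rewrite /k divfK// gt_eqF.
have h2 : (1 - k) * ln t - k * C <= ln t - q * S t.
  have := ler_wpM2l k0 (Sln t Tt); rewrite mulrA -qk; lra.
have h3 := expR_ge1Dx (ln t - q * S t).
have h4 : A / l <= expR (ln t - q * S t) by lra.
have -> : A = l * (A / l) by field; rewrite gt_eqF.
apply: (@le_trans _ _ (l * expR (ln t - q * S t))); first by rewrite ler_pM2l.
rewrite expRD lnK ?posrE// mulNr mulrA ler_pM2r ?expR_gt0//.
exact: HT1 (le_trans TT1 Tt).
Qed.

End ClockVersusLog.

Section Limf.
Context {R : realType} {F : set_system R} {FF : ProperFilter F}.
Implicit Types (f : R -> \bar R) (c : \bar R).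
Local Open Scope ereal_scope.

Lemma limf_einf_ge f c : (\forall t \near F, c <= f t) -> c <= limf_einf f F.
Proof.
move=> H; rewrite limf_einfE; apply: le_ereal_sup_tmp.
exists (ereal_inf (f @` [set t | c <= f t])); first by exists [set t | c <= f t].
by apply: le_ereal_inf_tmp => _ [t /= ct <-].
Qed.

Lemma limf_esup_le f c : (\forall t \near F, f t <= c) -> limf_esup f F <= c.
Proof.
move=> H; rewrite limf_esupE; apply: ge_ereal_inf.
exists (ereal_sup (f @` [set t | f t <= c])); first by exists [set t | f t <= c].
by apply: ge_ereal_sup => _ [t /= ct <-].
Qed.

Lemma limf_einf_le_esup f : limf_einf f F <= limf_esup f F.
Proof.
rewrite limf_einfE limf_esupE; apply: ge_ereal_sup => _ [V FV <-].
apply: le_ereal_inf_tmp => _ [W FW <-].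
have [t [Vt Wt]] := filter_ex (filterI FV FW).
apply: (@le_trans _ _ (f t)).
  by apply: ereal_inf_lbound; exists t.
by apply: ereal_sup_ubound; exists t.
Qed.

End Limf.

(** * Limits of the solution in the four regimes of lambda *)

Unset Implicit Arguments.
Set Strict Implicit.
Set Printing Implicit Defensive.

Theorem theorem25 (R : realType) (tau sigma g psi x : R -> R)
    (lambda : \bar R) (a b beta : R)
    (tau_cont : {within `[0, +oo[, continuous tau})
    (tau_ge0 : forall t : R, 0 <= t -> 0 <= tau t)
    (tau_lim : t - tau t @[t --> +oo] --> +oo)
    (sigma_cont : {within `[- taubar tau, +oo[, continuous sigma})
    (sigma_ge0 : forall t : R, - taubar tau <= t -> 0 <= sigma t)
    (sigma_int : forall u v : R, - taubar tau <= u -> u <= v ->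
       (int_inv sigma u v < +oo)%E)
    (sigma_int_infty : int_inv sigma 0 t @[t --> +oo] --> +oo%E)
    (sigma_infty : sigma t @[t --> +oo] --> +oo)
    (sigma_delay : int_inv sigma (t - tau t) t @[t --> +oo] --> 1%:E)
    (lambda_ge0 : (0 <= lambda)%E)
    (sigma_lambda : (sigma t / t)%:E @[t --> +oo] --> lambda)
    (b_gt0 : 0 < b) (ab : b < a)
    (g_cont : {within `[0, +oo[, continuous g})
    (g_ge0 : forall y : R, 0 <= y -> 0 <= g y)
    (g0 : g 0 = 0)
    (g_gt0 : forall y : R, 0 < y -> 0 < g y)
    (g_C1 : exists delta1 : R, [/\ 0 < delta1,
       forall y : R, 0 < y < delta1 -> derivable g y 1,
       {within `]0, delta1[, continuous (derive1 g)} &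
       forall y : R, 0 < y < delta1 -> 0 < derive1 g y])
    (beta_gt1 : 1 < beta)
    (g'_RV : RV0 (beta - 1) (derive1 g))
    (psi_cont : {within `[- taubar tau, 0], continuous psi})
    (psi_gt0 : forall t : R, - taubar tau <= t <= 0 -> 0 < psi t)
    (x_sol : is_solution a b g tau psi x)
    (x_lim : x t @[t --> +oo] --> 0) :
  [/\ lambda = 0%E ->
        x t / Ginv g t @[t --> +oo] --> (a - b) `^ (- (beta - 1)^-1),
      (0 < lambda < ((beta - 1) / beta * ln (a / b))%:E)%E ->
        let q := 1 - expR (- fine lambda) in
        let Lambda := (a - b * (1 / (1 - q)) `^ (beta / (beta - 1)))
                        `^ (- (beta - 1)^-1) in
        [/\ (Lambda%:E <= limf_einf (fun t => (x t / Ginv g t)%:E) (nbhs +oo%R))%E,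
            (limf_einf (fun t => (x t / Ginv g t)%:E) (nbhs +oo%R) <=
             limf_esup (fun t => (x t / Ginv g t)%:E) (nbhs +oo%R))%E &
            (limf_esup (fun t => (x t / Ginv g t)%:E) (nbhs +oo%R) < +oo)%E],
      (((beta - 1) / beta * ln (a / b))%:E < lambda < +oo)%E ->
        ln (x t) / ln t @[t --> +oo]
          --> - (1 / beta * (1 / fine lambda) * ln (a / b)) &
      lambda = +oo%E ->
        ln (x t) / fine (int_inv sigma 0 t) @[t --> +oo]
          --> - (1 / beta * ln (a / b))].
Proof.
have tb0 := taubar_le0 tau_ge0.
pose S (t : R) : R := fine (int_inv sigma 0 t).
have S_ge0 (t : R) : 0 <= S t := clock_ge0 tau_ge0 sigma_ge0 t.
have S_infty : S t @[t --> +oo] --> +oo.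
  exact: clock_infty tau_ge0 sigma_ge0 sigma_int sigma_int_infty.
have S_deriv := is_derive_clock tau_ge0 sigma_cont sigma_ge0 sigma_int sigma_infty.
have S_delay : S t - S (t - tau t) @[t --> +oo] --> (1 : R).
  exact: clock_delay tau_ge0 tau_lim sigma_cont sigma_ge0 sigma_int sigma_delay.
have x_gt0 (t : R) : 0 <= t -> 0 < x t.
  by move=> t0; apply: (sol_pos x_sol); exact: le_trans t0.
have x_deriv (t : R) : 0 < t -> is_derive t 1 x (rhs a b g tau x t).
  exact: (sol_deriv x_sol).
have gC1 : exists2 d : R, 0 < d & forall y : R, 0 < y < d -> derivable g y 1 /\ 0 < derive1 g y.
  by have [d [d0 gd _ g'd]] := g_C1; exists d => // y yd; split; [exact: gd|exact: g'd].
have gc := @g_continuous_at R g g_cont.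
have gn := g_ndecr_near0 gC1.
have grv := g_RV_of_derive g_cont g0 g_gt0 gC1 beta_gt1 g'_RV.
have b10 : 0 < beta - 1 by rewrite subr_gt0.
have beta0 : 0 < beta by rewrite (lt_trans ltr01).
have a0 : 0 < a by rewrite (lt_trans b_gt0).
pose mu := ln (a / b) / beta.
have mu0 : 0 < mu by rewrite divr_gt0// ln_gt0// ltr_pdivlMr// mul1r.
have threshold : (beta - 1) / beta * ln (a / b) = mu * (beta - 1).
  by rewrite /mu; ring.
have pt : \forall t \near +oo, t - tau t <= t.
  by apply/near_pinftyP; exists 1 => // t t1; rewrite gerBl tau_ge0// (le_trans _ t1).
(* The delayed time is asymptotically the fraction exp (- l) of t. *)
have slow l : lambda = l%:E -> 0 < a - b * expR (- l) `^ (- (beta / (beta - 1))) ->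
    x t / Ginv g t @[t --> +oo] -->
    (a - b * expR (- l) `^ (- (beta / (beta - 1)))) `^ (- (beta - 1)^-1).
  move=> lE; have /fine_cvgP[_ sl] : (sigma t / t)%:E @[t --> +oo] --> l%:E by rewrite -lE.
  have ratio := delay_ratio_cvg S_deriv sl tau_lim pt S_delay.
  exact: (slow_delay_limit b_gt0 g_gt0 gc gn beta_gt1 grv tau_ge0 tau_lim x_gt0 x_deriv x_lim
    (expR_gt0 _) ratio).
(* Here l only bounds sigma / t from below, so that lambda = +oo is covered. *)
have fast l : mu * (beta - 1) < l -> (\forall t \near +oo, l * t <= sigma t) ->
    ln (x t) / S t @[t --> +oo] --> - mu.
  move=> ml sl.
  apply: (fast_delay_limit b_gt0 g_gt0 gn beta_gt1 grv tau_ge0 tau_lim x_gt0 x_deriv x_lim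
    ab S_ge0 S_infty S_deriv S_delay).
  by apply: (clock_slow_of_linear S_deriv _ ml sl); rewrite mulr_ge0 ?ltW.
split.
- move=> l0; have := slow 0 l0; rewrite oppr0 expR0 powR1 mulr1 subr_gt0; exact.
- rewrite threshold; case: lambda lambda_ge0 sigma_lambda slow => [l _ _ slow|_ _ _ /andP[]//|//].
  rewrite !lte_fin /= => /andP[l0 lth].
  rewrite subKr div1r -powR_inv1 ?expR_ge0// -powRrM mulN1r.
  have Ks0 : 0 < a - b * expR (- l) `^ (- (beta / (beta - 1))).
    rewrite subr_gt0 mulrC -ltr_pdivlMr// /powR gt_eqF ?expR_gt0// expRK mulrNN.
    rewrite -[ltRHS]lnK ?posrE ?divr_gt0// ltr_expR.
    rewrite mulrAC ltr_pdivrMr//.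
    move: lth; rewrite /mu mulrAC ltr_pdivlMr// mulrC//.
  have lim := slow l erefl Ks0.
  set L := (_ `^ _) in lim *.
  split.
  + apply/lee_subgt0Pr => e e0; apply: limf_einf_ge.
    have N : \forall t \near +oo, L - e < x t / Ginv g t.
      by apply: cvgr_gt lim _ _; rewrite ltrBlDr ltrDl.
    by near=> t; rewrite lee_fin ltW//; near: t.
  + exact: limf_einf_le_esup.
  + apply: (@le_lt_trans _ _ (L + 1)%:E); last exact: ltry.
    apply: limf_esup_le.
    have N : \forall t \near +oo, x t / Ginv g t < L + 1.
      by apply: cvgr_lt lim _ _; rewrite ltrDl.
    by near=> t; rewrite lee_fin ltW//; near: t.
- rewrite threshold; case: lambda lambda_ge0 sigma_lambda {slow} => [l _|_ _ /andP[]//|//].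
  move=> /fine_cvgP[_ sl] /andP[]; rewrite lte_fin /= => lth _.
  have m0 : 0 < mu * (beta - 1) by rewrite mulr_gt0.
  have l0 : 0 < l by rewrite (lt_trans m0).
  pose l' := (mu * (beta - 1) + l) / 2.
  have N : \forall t \near +oo, l' < sigma t / t by apply: cvgr_gt sl _ _; rewrite /l'; lra.
  have xS : ln (x t) / S t @[t --> +oo] --> - mu.
    apply: (fast l'); first by rewrite /l'; lra.
    near=> t; rewrite -ler_pdivlMr; last by near: t; exact: nbhs_pinfty_gt.
    by apply: ltW; near: t.
  have lS := log_clock_ratio S_infty S_deriv sl.
  have -> : - (1 / beta * (1 / l) * ln (a / b)) = - mu * l^-1.
    by rewrite /mu; field; rewrite !gt_eqF.
  have : (ln (x t) / S t) * (ln t / S t)^-1 @[t --> +oo] --> - mu * l^-1.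
    by apply: cvgM => //; apply: cvgV => //; rewrite gt_eqF.
  apply: cvg_trans; apply: near_eq_cvg.
  have Sp : \forall t \near +oo, 0 < S t by move/cvgryPgt : S_infty => /(_ 0).
  near=> t; have St : 0 < S t by near: t.
  have t1 : 1 < t by near: t; exact: nbhs_pinfty_gt.
  by rewrite /=; field; rewrite !gt_eqF// ln_gt0.
- move=> lE; have -> : - (1 / beta * ln (a / b)) = - mu by rewrite /mu; ring.
  apply: (fast (mu * (beta - 1) + 1)); first by rewrite ltrDl.
  move: sigma_lambda; rewrite lE => /cvgeyPge/(_ (mu * (beta - 1) + 1)) N.
  near=> t; rewrite -ler_pdivlMr; last by near: t; exact: nbhs_pinfty_gt.
  by rewrite -lee_fin; near: t.
Unshelve. all: by end_near. Qed.
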